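(* Let an integer $\ell\ge 3$ be fixed, and let $p=p(n)>0$ be any function of $n$. Let $(G_n)$ be a sequence of graphs with $|G_n|=n$ such that $\sup_n t_p(F,G_n)<\infty$ for each $F\in\mathcal{T}\cup\mathcal{F}_{\ge\ell}\cup\{C_{2\ell-2}\}$, and suppose that $d_{\mathrm{cut}}(G_n,\kappa)\to 0$ for some bounded kernel $\kappa$. Then $t_p(F,G_n)\to s(F,\kappa)$ as $n\to\infty$ for each $F\in\mathcal{T}\cup\mathcal{F}_{\ge\ell}$.
   Context: Graphs are finite and simple unless stated otherwise; $|G|$ and $e(G)$ are the numbers of vertices and edges, and $C_m$ is the cycle with $m$ vertices. A sequence $(G_n)$ with $|G_n|=n$, $V(G_n)=\{1,\dots,n\}$, need only be defined for $n$ in an infinite subset of $\mathbb{N}$; limits are along that subset. $\hom(F,G)$ is the number of homomorphisms from $F$ to $G$, and for $|G|=n$, $t_p(F,G)=\hom(F,G)/(p^{e(F)}n^{|F|})$ with $p=p(n)$. $\mathcal{T}$ is the set of (isomorphism classes of) finite trees. For $\ell\ge 2$, $\mathcal{F}_{\ge\ell}$ is the set of (isomorphism classes of) simple graphs obtained from a finite loopless multigraph by subdividing each edge at least $\ell-1$ times (the number of subdivisions may differ from edge to edge). A kernel is a symmetric measurable function $\kappa:[0,1]^2\to[0,\infty)$. For a graph $F$ with vertex set $\{1,\dots,k\}$, $s(F,\kappa)=\int_{[0,1]^k}\prod_{ij\in E(F)}\kappa(x_i,x_j)\,dx_1\cdots dx_k$. The cut norm of an integrable $W:[0,1]^2\to\mathbb{R}$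 is $\|W\|_{\mathrm{cut}}=\sup_{S,T}\left|\int_{S\times T}W(x,y)\,dx\,dy\right|$, the supremum being over measurable $S,T\subset[0,1]$. For kernels, $d_{\mathrm{cut}}(\kappa_1,\kappa_2)=\inf_\tau\|\kappa_1-\kappa_2^{(\tau)}\|_{\mathrm{cut}}$, where $\tau$ runs over measure-preserving bijections $[0,1]\to[0,1]$ and $\kappa^{(\tau)}(x,y)=\kappa(\tau(x),\tau(y))$. To a graph $G$ with vertex set $\{1,\dots,n\}$ associate the kernel $\kappa_G$ equal to $1/p(n)$ on $((i-1)/n,i/n]\times((j-1)/n,j/n]$ whenever $ij\in E(G)$, and $0$ elsewhere; $d_{\mathrm{cut}}(G,\kappa)$ means $d_{\mathrm{cut}}(\kappa_G,\kappa)$. *)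

(* Defs.v *)
From HB Require Import structures.
From mathcomp Require Import all_boot all_order all_algebra.
From mathcomp Require Import all_classical all_reals all_analysis.
Import Order.TTheory GRing.Theory Num.Theory.
Import numFieldNormedType.Exports.

Set Implicit Arguments.
Unset Strict Implicit.
Unset Printing Implicit Defensive.

Local Open Scope classical_set_scope.
Local Open Scope ring_scope.

Record sgraph (V : finType) := SGraph {
  adj :> rel V;
  adj_sym : symmetric adj;
  adj_irrefl : irreflexive adj }.

Definition graph_iso (V W : finType) (e : rel V) (f : rel W) : Prop :=
  exists2 phi : V -> W, bijective phi & forall x y, f (phi x) (phi y) = e x y.

Definition nb_edges (k : nat) (F : sgraph 'I_k) : nat :=
  #|[pred ij : 'I_k * 'I_k | (ij.1 < ij.2)%N && F ij.1 ij.2]|.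

Definition nb_hom (V W : finType) (F : sgraph V) (G : sgraph W) : nat :=
  #|[pred f : {ffun V -> W} | [forall x, forall y, F x y ==> G (f x) (f y)]]|.

(* [ucycle F c] also holds for lists of length 0 and for [:: x; y] when xy is
   an edge; the genuine cycles are those of length at least 3. *)
Definition is_tree (V : finType) (F : sgraph V) : Prop :=
  [/\ (0 < #|V|)%N,
      forall x y, connect F x y
    & forall c : seq V, ucycle F c -> (size c <= 2)%N].

(* For m >= 3 this is C_m; the conjunct [i != j] only matters for m = 1. *)
Definition cycle_adj (m : nat) : rel 'I_m := fun i j =>
  (i != j) && ((j == i.+1 %[mod m]) || (i == j.+1 %[mod m])).

Lemma cycle_adj_sym m : symmetric (@cycle_adj m).
Proof. by move=> i j; rewrite /cycle_adj eq_sym orbC. Qed.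

Lemma cycle_adj_irrefl m : irreflexive (@cycle_adj m).
Proof. by move=> i; rewrite /cycle_adj eqxx. Qed.

Definition cycle_graph (m : nat) : sgraph 'I_m :=
  SGraph (@cycle_adj_sym m) (@cycle_adj_irrefl m).

Record multigraph := MultiGraph {
  mvertex : finType;
  medge : finType;
  mends : medge -> mvertex * mvertex;
  mloopless : forall e, (mends e).1 != (mends e).2 }.

Section Subdivision.
Variables (M : multigraph) (d : medge M -> nat).

(* The original vertices, together with d e new vertices for each edge e. *)
Definition subdiv_vertex : finType :=
  (mvertex M + {e : medge M & 'I_(d e)})%type.

(* The i-th vertex (0 <= i <= d e + 1) of the path replacing the edge e. *)
Definition subdiv_path (e : medge M) (i : nat) : subdiv_vertex :=
  if i is i'.+1 then
    if insub i' is Some j then inr (@Tagged _ e (fun e => 'I_(d e)) j)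
    else inl (mends e).2
  else inl (mends e).1.

Definition subdiv_adj : rel subdiv_vertex := fun x y =>
  [exists e : medge M, exists i : 'I_(d e).+1,
     ((x == subdiv_path e i) && (y == subdiv_path e i.+1))
  || ((y == subdiv_path e i) && (x == subdiv_path e i.+1))].

End Subdivision.

Definition in_Fge (l : nat) (V : finType) (F : sgraph V) : Prop :=
  exists (M : multigraph) (d : medge M -> nat),
    (forall e, (l.-1 <= d e)%N) /\ graph_iso F (@subdiv_adj M d).

Section Analysis.
Variable R : realType.

Local Notation mu := (@lebesgue_measure R).

Definition unitI : set R := `[0%R, 1%R]%classic.

(* Measurability is with respect to the Borel sigma-algebra of the square, and
   kappa is unconstrained outside the unit square. *)
Definition is_kernel (kappa : R -> R -> R) : Prop :=
  [/\ measurable_fun (unitI `*` unitI) (fun z : R * R => kappa z.1 z.2),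
      forall x y, unitI x -> unitI y -> kappa x y = kappa y x
    & forall x y, unitI x -> unitI y -> 0 <= kappa x y].

Definition bounded_kernel (kappa : R -> R -> R) : Prop :=
  exists M : R, forall x y, unitI x -> unitI y -> kappa x y <= M.

(* k-dimensional Lebesgue measure, as an iterated product measure carried over
   to tuples along (t, x) |-> x :: t. *)
Definition cons_pair (k : nat)
    (z : k.-tuple (measurableTypeR R) * measurableTypeR R) :
    k.+1.-tuple (measurableTypeR R) :=
  [the k.+1.-tuple (measurableTypeR R) of z.2 :: z.1].

Lemma measurable_cons_pair k : measurable_fun setT (@cons_pair k).
Proof. exact: measurable_cons measurable_snd measurable_fst. Qed.

Fixpoint lebesgue_tuple (k : nat) : set (k.-tuple (measurableTypeR R)) -> \bar R :=
  match k with
  | 0%N => \d_ [tuple]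
  | k'.+1 => pushforward (lebesgue_tuple (k := k') \x mu)%E (@cons_pair k')
  end.

Lemma lebesgue_tuple_measure k :
  exists m : {measure set (k.-tuple (measurableTypeR R)) -> \bar R},
    (m : set _ -> \bar R) = @lebesgue_tuple k.
Proof.
elim: k => [|k [m mE]] /=.
  by exists (dirac ([tuple] : 0.-tuple (measurableTypeR R))).
rewrite -mE.
by exists (measure_function_pushforward__canonical__measure_function_Measure
  (m \x mu)%E (@measurable_cons_pair k)).
Qed.

Section LebesgueTupleIsMeasure.
Variable k : nat.

Let lebesgue_tuple0 : @lebesgue_tuple k set0 = 0%E.
Proof. by have [m <-] := lebesgue_tuple_measure k. Qed.

Let lebesgue_tuple_ge0 A : (0 <= @lebesgue_tuple k A)%E.
Proof. by have [m <-] := lebesgue_tuple_measure k. Qed.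

Let lebesgue_tuple_sigma_additive : semi_sigma_additive (@lebesgue_tuple k).
Proof.
have [m <-] := lebesgue_tuple_measure k; exact: measure_semi_sigma_additive.
Qed.

HB.instance Definition _ := isMeasure.Build _ _ _ (@lebesgue_tuple k)
  lebesgue_tuple0 lebesgue_tuple_ge0 lebesgue_tuple_sigma_additive.

End LebesgueTupleIsMeasure.

Lemma lebesgue_tuple_box k (A : 'I_k -> set (measurableTypeR R)) :
  (forall i, measurable (A i)) ->
  @lebesgue_tuple k [set x | forall i, A i (tnth x i)] = (\prod_(i < k) mu (A i))%E.
Proof.
elim: k A => [|k IH] A mA.
  rewrite big_ord0 /= diracE mem_set // => -[].
  by [].
rewrite big_ord_recl /= muleC -IH; last by move=> i; exact: mA.
rewrite /pushforward.
pose B := [set x : k.-tuple (measurableTypeR R) |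
  forall i, A (lift ord0 i) (tnth x i)].
rewrite (_ : _ @^-1` _ = B `*` A ord0); last first.
  apply/seteqP; split => -[t x] /=.
    move=> h; split; last exact: (h ord0).
    by move=> i; have := h (lift ord0 i); rewrite tnthS.
  by move=> [h hx] i; case: (unliftP ord0 i) => [j|] -> //; rewrite tnthS.
apply: product_measure1E => //.
rewrite (_ : B = \bigcap_(i in [set: 'I_k]) ((@tnth k (measurableTypeR R))^~ i @^-1` A (lift ord0 i))); last first.
  by apply/seteqP; split => x /= h i; [move=> _; exact: h|exact: h].
apply: fin_bigcap_measurable => // i _.
by rewrite -[X in measurable X]setTI; apply: measurable_tnth.
Qed.

Definition hom_integral (k : nat) (F : sgraph 'I_k) (kappa : R -> R -> R) : \bar R :=
  (\int[@lebesgue_tuple k]_(x in [set x | forall i, unitI (tnth x i)])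
     (\prod_(i < k) \prod_(j < k | (i < j)%N && F i j)
        kappa (tnth x i) (tnth x j))%:E)%E.

Definition cut_norm (W : R -> R -> R) : \bar R :=
  ereal_sup [set z | exists S T : set (measurableTypeR R),
    [/\ measurable S, measurable T, S `<=` unitI, T `<=` unitI
      & z = `| \int[(mu \x mu)%E]_(x in S `*` T) (W x.1 x.2)%:E |%E]].

Definition mp_bijection (tau : R -> R) : Prop :=
  [/\ set_bij unitI unitI tau,
      measurable_fun (unitI : set (measurableTypeR R)) tau
    & forall A : set (measurableTypeR R), measurable A -> A `<=` unitI ->
        mu (unitI `&` tau @^-1` A) = mu A].

Definition d_cut (kappa1 kappa2 : R -> R -> R) : \bar R :=
  ereal_inf [set cut_norm (fun x y => kappa1 x y - kappa2 (tau x) (tau y))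
            | tau in mp_bijection].

(* The vertices 1, ..., n are the elements 0, ..., n - 1 of 'I_n here. *)
Definition graph_kernel (p : R) (n : nat) (G : sgraph 'I_n) (x y : R) : R :=
  if [exists i : 'I_n, exists j : 'I_n,
        [&& G i j, i%:R / n%:R < x <= i.+1%:R / n%:R
                 & j%:R / n%:R < y <= j.+1%:R / n%:R]]
  then p^-1 else 0.

Definition t_density (p : R) (k n : nat) (F : sgraph 'I_k) (G : sgraph 'I_n) : R :=
  (nb_hom F G)%:R / (p ^+ nb_edges F * n%:R ^+ k).

End Analysis.

(* Main.v *)
From HB Require Import structures.
Require Import Defs.
From mathcomp Require Import all_boot all_order all_algebra.
From mathcomp Require Import all_classical all_reals all_analysis measurable_realfun.
From mathcomp Require Import ring lra.
Import Order.TTheory GRing.Theory Num.Theory.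
Import numFieldNormedType.Exports.

Set Implicit Arguments.
Unset Strict Implicit.
Unset Printing Implicit Defensive.

Local Open Scope ring_scope.

(** The idea is to compare, on one finite probability space, the rescaled
    adjacency matrix W of the graph with a step kernel K approximating kappa.

    Put kappa into L1-close step form: kappa x y is close to v (c x) (c y) for
    a measurable map c to a finite set (kernel_step_approx), and replacing one
    by the other changes the homomorphism integral of a fixed graph little
    (hom_integral_dist).  Given n and a nearly optimal rearrangement tau, the
    common refinement of the n grid intervals and of the partition c o tau has
    finitely many cells.  Weighted by their Lebesgue measure, they form a
    probability space on which W depends on the grid interval and K on the
    class of c o tau; the densities of F are the mean of a product of values
    of W, resp. K, and W - K is small on products of sets of cells (pull_cut).
    It remains to prove a counting lemma for such pairs, where K is bounded
    but W is not (finite_counting).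

    The unbounded W is handled by truncation, and only a few densities enter.
    Stars bound all moments of the degree, and then all moments of every
    function obtained by integrating a rooted tree
    (moments_bounded_tree_eval).  With moments at hand, an edge of a tree can
    be replaced against an arbitrary test function at its end (edge_vanish),
    and a tree is treated by induction from its leaves (tree_vanish).

    A subdivided multigraph is a union of long paths, and its density is the
    mean of the product over the paths of the iterated kernels W o ... o W at
    their ends (hom_mean_paths).  Parallel paths between two vertices show that
    these iterated kernels have bounded moments, so it suffices that W o ... o W
    converges in L1 to K o ... o K for walks of at least l edges, and to
    multiply (vanish_prod).  Expand the difference one edge at a time.  Terms
    with a bounded factor K at an end are small in L1 by the definition of the
    cut norm (comp_path_kernel_vanish).  The term (W - K) o W o ... o W
    is small because the tail W o ... o W, of at least l - 1 factors, is bounded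
    in L2: for exactly l - 1 factors its squared L2 norm is the density of the
    cycle of length 2l - 2, and longer tails have bounded moments as above.
    Such a function can be truncated with uniformly small error
    (path_kernel_vanish). *)

(** * Means over finite weighted spaces *)

Record finprob (R : realFieldType) := FinProb {
  fcar :> finType;
  wt : fcar -> R;
  wt_ge0 : forall x, 0 <= wt x;
  wt_sum : \sum_x wt x = 1 }.

Section Mean.
Variable R : realFieldType.
Implicit Types S T : finprob R.

Definition mean S (f : S -> R) : R := \sum_x wt x * f x.

Lemma eq_mean S (f g : S -> R) : f =1 g -> mean f = mean g.
Proof. by move=> fg; apply: eq_bigr => x _; rewrite fg. Qed.

Lemma mean_ge0 S (f : S -> R) : (forall x, 0 <= f x) -> 0 <= mean f.
Proof. by move=> f0; apply: sumr_ge0 => x _; rewrite mulr_ge0 ?wt_ge0. Qed.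

Lemma ler_mean S (f g : S -> R) : (forall x, f x <= g x) -> mean f <= mean g.
Proof. by move=> fg; apply: ler_sum => x _; rewrite ler_wpM2l ?wt_ge0. Qed.

Lemma meanD S (f g : S -> R) : mean (fun x => f x + g x) = mean f + mean g.
Proof. by rewrite /mean -big_split /=; apply: eq_bigr => x _; rewrite mulrDr. Qed.

Lemma meanB S (f g : S -> R) : mean (fun x => f x - g x) = mean f - mean g.
Proof.
by rewrite /mean -sumrB; apply: eq_bigr => x _; rewrite mulrBr.
Qed.

Lemma meanZ S c (f : S -> R) : mean (fun x => c * f x) = c * mean f.
Proof. by rewrite /mean mulr_sumr; apply: eq_bigr => x _; rewrite mulrCA. Qed.

Lemma meanZr S c (f : S -> R) : mean (fun x => f x * c) = mean f * c.
Proof. by rewrite mulrC -meanZ; apply: eq_mean => x; rewrite mulrC. Qed.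

Lemma mean_cst S c : mean (fun _ : S => c) = c.
Proof. by rewrite /mean -mulr_suml wt_sum mul1r. Qed.

Lemma ler_norm_mean S (f : S -> R) : `|mean f| <= mean (fun x => `|f x|).
Proof.
apply: le_trans (ler_norm_sum _ _ _) _; apply: ler_sum => x _.
by rewrite normrM (ger0_norm (wt_ge0 _)).
Qed.

Lemma mean_swap S T (f : S -> T -> R) :
  mean (fun x => mean (f x)) = mean (fun y => mean (f^~ y)).
Proof.
rewrite /mean.
under eq_bigr do rewrite mulr_sumr; rewrite exchange_big /=.
by apply: eq_bigr => y _; rewrite mulr_sumr; apply: eq_bigr => x _; rewrite mulrCA.
Qed.

Lemma prod_wt_ge0 S T (z : S * T) : 0 <= wt z.1 * wt z.2.
Proof. by rewrite mulr_ge0 ?wt_ge0. Qed.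

Lemma prod_wt_sum S T : \sum_(z : S * T) wt z.1 * wt z.2 = 1.
Proof.
rewrite -(pair_bigA _ (fun (x : S) (y : T) => wt x * wt y)) /=.
by under eq_bigr do rewrite -mulr_sumr wt_sum mulr1; rewrite wt_sum.
Qed.

Definition prod_prob S T : finprob R :=
  @FinProb R (S * T)%type _ (@prod_wt_ge0 S T) (prod_wt_sum S T).

Lemma mean_prod S T (f : S -> T -> R) :
  mean (S := prod_prob S T) (fun z => f z.1 z.2) = mean (fun x => mean (f x)).
Proof.
rewrite /mean /= -(pair_bigA _ (fun (x : S) (y : T) => wt x * wt y * f x y)) /=.
by apply: eq_bigr => x _; rewrite mulr_sumr; apply: eq_bigr => y _; rewrite mulrA.
Qed.

(** Cauchy-Schwarz for the weight a: sum 2 (f x) (f y) <= (f x)^2 + (f y)^2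
    against a x a y. *)
Lemma mean_sqr_le S (a f : S -> R) : (forall x, 0 <= a x) ->
  mean (fun x => a x * f x) ^+ 2 <= mean a * mean (fun x => a x * f x ^+ 2).
Proof.
move=> a0; set b := mean _; set d := mean a; set c := mean _.
have E1 : b ^+ 2 = mean (fun x => mean (fun y => (a x * f x) * (a y * f y))).
  by rewrite expr2 {1}/b -meanZr; apply: eq_mean => x; rewrite meanZ.
have E2 : d * c = mean (fun x => mean (fun y => a x * (a y * f y ^+ 2))).
  by rewrite -meanZr; apply: eq_mean => x; rewrite meanZ.
have E3 : c * d = mean (fun x => mean (fun y => (a x * f x ^+ 2) * a y)).
  by rewrite -meanZr; apply: eq_mean => x; rewrite meanZ.
have : 2 * b ^+ 2 <= d * c + c * d.
  rewrite E1 E2 E3 -meanD -meanZ; apply: ler_mean => x.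
  rewrite -meanD -meanZ; apply: ler_mean => y.
  have := mulr_ge0 (mulr_ge0 (a0 x) (a0 y)) (sqr_ge0 (f x - f y)).
  nra.
rewrite (mulrC c); lra.
Qed.

End Mean.

(** * Negligible quantities and bounded moments *)

Section Vanish.
Variables (R : realFieldType) (I : Type) (eps : I -> R).
Implicit Types (a b : I -> R).

(** Here eps i is the cut distance in the i-th system of a family; the
    quantities below tend to 0 with it at a rate common to the family. *)
Definition vanish a := forall eta, 0 < eta ->
  exists2 delta, 0 < delta & forall i, eps i <= delta -> `|a i| <= eta.

Lemma vanish_le a b : vanish b -> (forall i, `|a i| <= b i) -> vanish a.
Proof.
move=> vb ab eta e0; have [d d0 hd] := vb _ e0; exists d => // i /hd.
by apply: le_trans; exact: le_trans (ab i) (ler_norm _).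
Qed.

Lemma vanishD a b : vanish a -> vanish b -> vanish (fun i => a i + b i).
Proof.
move=> va vb eta e0; have e2 : 0 < eta / 2 by lra.
have [d d0 hd] := va _ e2; have [d' d'0 hd'] := vb _ e2.
exists (Num.min d d') => [|i]; first by rewrite lt_min d0.
rewrite le_min => /andP[/hd h /hd' h'].
by apply: le_trans (ler_normD _ _) _; rewrite (splitr eta) lerD.
Qed.

Lemma vanishZ c a : vanish a -> vanish (fun i => c * a i).
Proof.
move=> va eta e0; have c0 : 0 < `|c| + 1 by rewrite ltr_wpDl.
have [|d d0 hd] := va (eta / (`|c| + 1)); first by rewrite divr_gt0.
exists d => // i /hd; rewrite ler_pdivlMr // normrM => h.
apply: le_trans h; rewrite mulrC ler_wpM2l // lerDl //.
Qed.

Lemma vanish_eps c : (forall i, 0 <= eps i) -> vanish (fun i => c * eps i).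
Proof.
move=> e0; apply: vanishZ => eta eta0; exists eta => // i.
by rewrite ger0_norm.
Qed.

(** This is how truncation is used: cutting an unbounded function at level N
    leaves a main term governed by the cut norm and a tail of order 1 / N. *)
Lemma vanish_trunc a C :
  (forall N, 0 < N -> exists2 b, vanish b & forall i, `|a i| <= b i + C / N) ->
  vanish a.
Proof.
move=> h eta e0; pose N := 2 * `|C| / eta + 1.
have N0 : 0 < N by rewrite ltr_wpDl // divr_ge0 ?mulr_ge0 // ltW.
have [b vb ab] := h _ N0; have [|d d0 hd] := vb (eta / 2); first by lra.
exists d => // i /hd hb; apply: le_trans (ab i) _.
have : C / N <= eta / 2.
  rewrite ler_pdivrMr // /N mulrDr mulr1.
  have -> : eta / 2 * (2 * `|C| / eta) = `|C| by field; rewrite ?gt_eqF.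
  apply: le_trans (ler_norm C) _; lra.
by have := ler_norm (b i); lra.
Qed.

Lemma eq_vanish a b : a =1 b -> vanish a -> vanish b.
Proof.
by move=> ab va eta /va[d d0 h]; exists d => // i /h; rewrite ab.
Qed.

Section MomentsBounded.
Variable S : I -> finprob R.
Implicit Types f g : forall i, S i -> R.

(** The exponents 2 ^ m control all moments, and they are the ones reached by
    squaring repeatedly. *)
Definition moments_bounded f := (forall i x, 0 <= f i x) /\
  forall m, exists C, forall i, mean (fun x => f i x ^+ (2 ^ m)) <= C.

Lemma moments_bounded_mean f : moments_bounded f ->
  exists C, forall i, mean (f i) <= C.
Proof. by case=> _ /(_ 0%N). Qed.

Lemma moments_bounded_le f g : moments_bounded g ->
  (forall i x, 0 <= f i x <= g i x) -> moments_bounded f.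
Proof.
move=> [g0 hg] fg; split=> [i x|m]; first by have /andP[] := fg i x.
have [C hC] := hg m; exists C => i; apply: le_trans (hC i); apply: ler_mean => x.
by have /andP[? ?] := fg i x; rewrite lerXn2r ?nnegrE.
Qed.

Lemma moments_bounded_cst c : 0 <= c -> moments_bounded (fun i _ => c).
Proof.
by move=> c0; split=> // m; exists (c ^+ (2 ^ m)) => i; rewrite mean_cst.
Qed.

Lemma moments_bounded_mul f g : moments_bounded f -> moments_bounded g ->
  moments_bounded (fun i x => f i x * g i x).
Proof.
move=> [f0 hf] [g0 hg]; split=> [i x|m]; first by rewrite mulr_ge0.
have [C hC] := hf m.+1; have [D hD] := hg m.+1; exists (C + D) => i.
apply: le_trans (lerD (hC i) (hD i)); rewrite -meanD; apply: ler_mean => x.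
rewrite exprMn expnSr !exprM.
have := exprn_ge0 (2 ^ m) (f0 i x); have := exprn_ge0 (2 ^ m) (g0 i x).
set u := _ ^+ _; set v := _ ^+ _; nra.
Qed.

Lemma moments_bounded_exp f n : moments_bounded f ->
  moments_bounded (fun i x => f i x ^+ n).
Proof.
move=> hf; elim: n => [|n IH].
  by apply: moments_bounded_le (moments_bounded_cst ler01) _ => i x; rewrite expr0 ler01 lexx.
by apply: moments_bounded_le (moments_bounded_mul hf IH) _ => i x;
  rewrite exprS lexx mulr_ge0 ?exprn_ge0 //; case: hf.
Qed.

Lemma moments_bounded_add f g : moments_bounded f -> moments_bounded g ->
  moments_bounded (fun i x => f i x + g i x).
Proof.
move=> [f0 hf] [g0 hg]; split=> [i x|m]; first by rewrite addr_ge0.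
have [C hC] := hf m; have [D hD] := hg m.
exists (2 ^+ (2 ^ m) * (C + D)) => i; set q := (2 ^ m)%N.
apply: le_trans (ler_wpM2l (exprn_ge0 _ _) (lerD (hC i) (hD i))) => //.
rewrite -meanD -meanZ; apply: ler_mean => x; rewrite -/q.
wlog fg : f g f0 g0 {hf hg hC hD} / f i x <= g i x.
  move=> h; have [fg|/ltW gf] := leP (f i x) (g i x); first exact: h.
  by rewrite addrC (addrC (_ ^+ q)); apply: h.
apply: (@le_trans _ _ (2 ^+ q * g i x ^+ q)).
  rewrite -exprMn lerXn2r ?nnegrE ?addr_ge0 ?mulr_ge0 //; lra.
by rewrite ler_wpM2l ?exprn_ge0 // lerDr exprn_ge0.
Qed.

Lemma moments_bounded_prod (E : Type) (r : seq E) (h : E -> forall i, S i -> R) :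
  (forall e, moments_bounded (h e)) ->
  moments_bounded (fun i x => \prod_(e <- r) h e i x).
Proof.
move=> hh; elim: r => [|e r IH].
  by apply: moments_bounded_le (moments_bounded_cst ler01) _ => i x; rewrite big_nil ler01 lexx.
apply: moments_bounded_le (moments_bounded_mul (hh e) IH) _ => i x.
by rewrite big_cons lexx mulr_ge0 ?(proj1 (hh e)) ?prodr_ge0 // => *; apply: (proj1 (hh _)).
Qed.

(** Where b <= N the product is at most N |f|; elsewhere it is at most
    |f| b^2 / N <= (g^2 + b^4) / N, whose mean is O(1 / N). *)
Lemma vanish_mul_moments_bounded f g (b : forall i, S i -> R) :
  moments_bounded g -> moments_bounded b ->
  (forall i x, `|f i x| <= g i x) -> vanish (fun i => mean (fun x => `|f i x|)) ->
  vanish (fun i => mean (fun x => `|f i x| * b i x)).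
Proof.
move=> hg hb fg vf.
have [C hC] :=
  moments_bounded_mean (moments_bounded_add (moments_bounded_exp 2 hg)
    (moments_bounded_exp 4 hb)).
apply: (@vanish_trunc _ C) => N N0.
exists (fun i => N * mean (fun x => `|f i x|)); first exact: vanishZ.
have b0 := proj1 hb; have g0 := proj1 hg.
move=> i; rewrite ger0_norm; last by apply: mean_ge0 => x; rewrite mulr_ge0.
have : mean (fun x => `|f i x| * b i x) <=
   N * mean (fun x => `|f i x|) + (mean (fun x => g i x ^+ 2 + b i x ^+ 4)) / N.
  rewrite -meanZ -meanZr -meanD; apply: ler_mean => x.
  move: (fg i x) (b0 i x) (g0 i x) (normr_ge0 (f i x)).
  move: `|_| (g i x) (b i x) => u v w uv w0 v0 u0.
  have [wN|Nw] := leP w N.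
    have : 0 <= (v ^+ 2 + w ^+ 4) / N.
      by apply: divr_ge0; [apply: addr_ge0; apply: exprn_ge0|exact: ltW].
    by have := ler_wpM2l u0 wN; rewrite mulrC => h1 h2; rewrite mulrC in h1; lra.
  have : u * w <= (v ^+ 2 + w ^+ 4) / N.
    rewrite ler_pdivlMr //.
    have h1 : u * w * N <= v * w ^+ 2.
      by rewrite expr2 mulrA ler_pM ?(ler_wpM2r w0 uv) ?mulr_ge0 ?(ltW N0) ?(ltW Nw).
    apply: le_trans h1 _.
    have -> : w ^+ 4 = (w ^+ 2) ^+ 2 by rewrite -exprM.
    have := sqr_ge0 (w ^+ 2); have := sqr_ge0 v.
    have := sqr_ge0 (v - w ^+ 2); nra.
  nra.
by move/le_trans; apply; rewrite lerD2l ler_wpM2r // invr_ge0 ltW.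
Qed.

(** Telescoping: change one factor at a time, the other factors having bounded
    moments. *)
Lemma vanish_prod (E : Type) (r : seq E) (g h : E -> forall i, S i -> R) :
  (forall e, moments_bounded (g e)) -> (forall e, moments_bounded (h e)) ->
  (forall e, vanish (fun i => mean (fun x => `|g e i x - h e i x|))) ->
  vanish (fun i => mean (fun x => `|\prod_(e <- r) g e i x - \prod_(e <- r) h e i x|)).
Proof.
move=> hg hh v; elim: r => [|e r IH].
  move=> eta e0; exists 1 => // i _.
  under eq_mean do rewrite !big_nil subrr normr0.
  by rewrite mean_cst normr0 ltW.
have Pg := moments_bounded_prod r hg; have Ph := moments_bounded_prod r hh.
have g0 e' i x : 0 <= g e' i x by case: (hg e').
have h0 e' i x : 0 <= h e' i x by case: (hh e').
have B (x y : R) : 0 <= x -> 0 <= y -> `|x - y| <= x + y.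
  by move=> x0 y0; rewrite ler_norml; lra.
have V1 := @vanish_mul_moments_bounded (fun i x => g e i x - h e i x) _ _
  (moments_bounded_add (hg e) (hh e)) Pg (fun i x => B _ _ (g0 e i x) (h0 e i x)) (v e).
have V2 := @vanish_mul_moments_bounded
  (fun i x => \prod_(e <- r) g e i x - \prod_(e <- r) h e i x) _ _
  (moments_bounded_add Pg Ph) (hh e) (fun i x => B _ _ (proj1 Pg i x) (proj1 Ph i x)) IH.
apply: vanish_le (vanishD V1 V2) _ => i.
rewrite ger0_norm ?mean_ge0 // -meanD; apply: ler_mean => x; rewrite !big_cons.
set u := \prod_(_ <- _) _; set w := \prod_(_ <- _) _.
have -> : g e i x * u - h e i x * w = (g e i x - h e i x) * u + h e i x * (u - w).
  by ring.
apply: le_trans (ler_normD _ _) _; rewrite !normrM [X in _ + X <= _]mulrC.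
by rewrite (ger0_norm (h0 e i x)) (ger0_norm (proj1 Pg i x)).
Qed.

End MomentsBounded.
End Vanish.

(** * Kernels, paths and rooted trees *)

Section Kernels.
Variables (R : realFieldType) (S : finprob R).
Implicit Types (U V : S -> S -> R) (f g : S -> R).

Definition kernel_op U f x := mean (fun y => U x y * f y).

Lemma kernel_op_adj U f g : (forall x y, U x y = U y x) ->
  mean (fun x => f x * kernel_op U g x) = mean (fun x => kernel_op U f x * g x).
Proof.
move=> sU; rewrite -[LHS](@eq_mean _ _ (fun x => mean (fun y => f x * (U x y * g y))));
  last first.
  by move=> x; rewrite meanZ.
rewrite mean_swap; apply: eq_mean => y; rewrite -meanZr; apply: eq_mean => x.
by rewrite (sU y x); ring.
Qed.

Lemma kernel_op_ge0 U f : (forall x y, 0 <= U x y) -> (forall x, 0 <= f x) ->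
  forall x, 0 <= kernel_op U f x.
Proof. by move=> U0 f0 x; apply: mean_ge0 => y; rewrite mulr_ge0. Qed.

Definition kernel_comp U V x y := mean (fun z => U x z * V z y).

(** The parameter d counts inner vertices: these are weighted walks with d + 1
    edges, matching the d new vertices on a subdivided edge. *)
Fixpoint path_kernel U d :=
  if d is d'.+1 then kernel_comp U (path_kernel U d') else U.

Lemma eq_kernel_comp U V U' V' : U =2 U' -> V =2 V' ->
  kernel_comp U V =2 kernel_comp U' V'.
Proof. by move=> h h' x y; apply: eq_mean => z; rewrite h h'. Qed.

Lemma kernel_compA U V T :
  kernel_comp U (kernel_comp V T) =2 kernel_comp (kernel_comp U V) T.
Proof.
move=> x y; rewrite /kernel_comp.
under eq_mean do rewrite -meanZ; rewrite mean_swap; apply: eq_mean => z.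
by rewrite -meanZr; apply: eq_mean => u; rewrite mulrA.
Qed.

Lemma path_kernelSr U d : path_kernel U d.+1 =2 kernel_comp (path_kernel U d) U.
Proof.
elim: d => [|d IH] // x y.
rewrite [RHS](_ : _ = kernel_comp (kernel_comp U (path_kernel U d)) U x y) // -kernel_compA.
by apply: eq_kernel_comp => // ? ?; rewrite -IH.
Qed.

Lemma path_kernel_sym U d : (forall x y, U x y = U y x) ->
  forall x y, path_kernel U d x y = path_kernel U d y x.
Proof.
move=> sU; elim: d => [|d IH] // x y; rewrite path_kernelSr; apply: eq_mean => z.
by rewrite mulrC sU IH.
Qed.

Lemma path_kernel_ge0 U d : (forall x y, 0 <= U x y) ->
  forall x y, 0 <= path_kernel U d x y.
Proof.
by move=> U0; elim: d => [|d IH] // x y; apply: mean_ge0 => z; rewrite mulr_ge0.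
Qed.

Lemma path_kernel_le U d M : (forall x y, 0 <= U x y <= M) ->
  forall x y, path_kernel U d x y <= M ^+ d.+1.
Proof.
move=> UM; have U0 x y : 0 <= U x y by case/andP: (UM x y).
elim: d => [|d IH] x y /=; first by case/andP: (UM x y).
rewrite -(mean_cst S (M ^+ _)); apply: ler_mean => z; rewrite exprS.
by rewrite ler_pM ?path_kernel_ge0 //; case/andP: (UM x z).
Qed.

Lemma mean_path_kernel U d x :
  mean (fun y => path_kernel U d x y) = iter d.+1 (kernel_op U) (fun=> 1) x.
Proof.
elim: d x => [|d IH] x; first by apply: eq_mean => y; rewrite mulr1.
rewrite [RHS]/= /kernel_op mean_swap; apply: eq_mean => z; rewrite meanZ IH //.
Qed.

(** Rooted trees as they arise by integrating from the leaves: gluing two trees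
    at their roots multiplies their functions of the root, and hanging a tree
    by an edge from a new root applies the kernel operator. *)
Inductive rooted_tree :=
| RTVertex
| RTGlue of rooted_tree & rooted_tree
| RTPlant of rooted_tree.

Fixpoint tree_eval U (t : rooted_tree) : S -> R :=
  match t with
  | RTVertex => fun=> 1
  | RTGlue t1 t2 => fun x => tree_eval U t1 x * tree_eval U t2 x
  | RTPlant t1 => kernel_op U (tree_eval U t1)
  end.

Lemma tree_eval_ge0 U t : (forall x y, 0 <= U x y) -> forall x, 0 <= tree_eval U t x.
Proof.
move=> U0; elim: t => [|t1 h1 t2 h2|t h] x /=; rewrite ?mulr_ge0 //.
exact: kernel_op_ge0.
Qed.

End Kernels.

Fixpoint tree_bound (R : realFieldType) (M : R) (t : rooted_tree) : R :=
  match t with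
  | RTVertex => 1
  | RTGlue t1 t2 => tree_bound M t1 * tree_bound M t2
  | RTPlant t1 => M * tree_bound M t1
  end.

Lemma tree_eval_le (R : realFieldType) (S : finprob R) (U : S -> S -> R) M t :
  (forall x y, 0 <= U x y <= M) -> forall x, tree_eval U t x <= tree_bound M t.
Proof.
move=> UM; have U0 x y : 0 <= U x y by case/andP: (UM x y).
elim: t => [|t1 h1 t2 h2|t h] x //=; first by rewrite ler_pM ?tree_eval_ge0.
rewrite -(mean_cst S (M * _)); apply: ler_mean => z.
by rewrite ler_pM ?tree_eval_ge0 //; case/andP: (UM x z).
Qed.

(** * The cut norm tested against bounded functions *)

Section Cut.
Variables (R : realFieldType) (S : finprob R).
Implicit Types (f g : S -> R).

(** A linear functional on functions with values in [0, 1] is largest at the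
    indicator of the set where its density is nonnegative, and smallest at the
    indicator of the set where it is nonpositive. *)
Lemma mean_extreme f (a : S -> R) : (forall x, 0 <= f x <= 1) ->
  exists A : pred S, `|mean (fun x => f x * a x)| <= `|mean (fun x => (A x)%:R * a x)|.
Proof.
move=> f01; set m := mean _.
have [m0|m0] := leP 0 m.
  exists (fun x => 0 <= a x)%R.
  rewrite ger0_norm // ger0_norm; last by apply: mean_ge0 => x;
    case: (leP 0 (a x)) => ? /=; rewrite ?mulr1n ?mulr0n; lra.
  by apply: ler_mean => x; have := f01 x; case: (leP 0 (a x)) => ? /=;
    rewrite ?mulr1n ?mulr0n; nra.
exists (fun x => a x <= 0).
rewrite ltr0_norm // ler0_norm; last first.
  rewrite -oppr_ge0 -mulN1r -meanZ.
  by apply: mean_ge0 => x; case: (leP (a x) 0) => ? /=; rewrite ?mulr1n ?mulr0n; lra.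
by rewrite lerN2; apply: ler_mean => x; have := f01 x; case: (leP (a x) 0) => ? /=;
  rewrite ?mulr1n ?mulr0n; nra.
Qed.

Variables (D : S -> S -> R) (e : R).
Hypothesis cutD : forall A B : pred S,
  `|mean (fun x => mean (fun y => (A x)%:R * (B y)%:R * D x y))| <= e.

Lemma cut_fun01 f g : (forall x, 0 <= f x <= 1) -> (forall x, 0 <= g x <= 1) ->
  `|mean (fun x => mean (fun y => f x * g y * D x y))| <= e.
Proof.
move=> f01 g01.
have [A hA] := mean_extreme (fun x => mean (fun y => g y * D x y)) f01.
have [B hB] := mean_extreme (fun y => mean (fun x => (A x)%:R * D x y)) g01.
apply: le_trans (cutD A B); apply: le_trans (le_trans _ hA) _.
  rewrite le_eqVlt; apply/orP; left; apply/eqP; congr `|_|; apply: eq_mean => x.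
  by rewrite -meanZ; apply: eq_mean => y; rewrite mulrA.
apply: le_trans (le_trans _ hB) _; rewrite le_eqVlt; apply/orP; left; apply/eqP; congr `|_|.
  rewrite [RHS](@eq_mean _ _ _ (fun y => mean (fun x => g y * ((A x)%:R * D x y)))); last first.
    by move=> y; rewrite meanZ.
  rewrite [RHS]mean_swap; apply: eq_mean => x; rewrite -meanZ; apply: eq_mean => y; ring.
rewrite [RHS]mean_swap; apply: eq_mean => y; rewrite -meanZ; apply: eq_mean => x; ring.
Qed.

Lemma cut_fun f g c d : 0 < c -> 0 < d ->
  (forall x, 0 <= f x <= c) -> (forall x, 0 <= g x <= d) ->
  `|mean (fun x => mean (fun y => f x * g y * D x y))| <= c * d * e.
Proof.
move=> c0 d0 fc gd.
have := @cut_fun01 (fun x => f x / c) (fun y => g y / d).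
have -> : mean (fun x => mean (fun y => f x / c * (g y / d) * D x y)) =
    mean (fun x => mean (fun y => f x * g y * D x y)) / (c * d).
  rewrite -meanZr; apply: eq_mean => x; rewrite -meanZr; apply: eq_mean => y.
  by field; rewrite !gt_eqF.
rewrite normrM normfV (gtr0_norm (mulr_gt0 c0 d0)) ler_pdivrMr ?mulr_gt0 //.
rewrite (mulrC e); apply.
  by move=> x; have /andP[? ?] := fc x; rewrite divr_ge0 ?(ltW c0) //= ler_pdivrMr // mul1r.
by move=> x; have /andP[? ?] := gd x; rewrite divr_ge0 ?(ltW d0) //= ler_pdivrMr // mul1r.
Qed.

(** Only one variable is tested against g, so the sign of the inner mean can
    serve as the test function in the other variable, on two sets. *)
Lemma cut_L1 g d : 0 < d -> (forall x, 0 <= g x <= d) ->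
  mean (fun x => `|mean (fun y => D x y * g y)|) <= 2 * d * e.
Proof.
move=> d0 gd; set h := fun x => mean (fun y => D x y * g y).
have H (A : pred S) : `|mean (fun x => (A x)%:R * h x)| <= d * e.
  have A01 x : 0 <= ((A x)%:R : R) <= 1 by case: (A x); rewrite ?lexx ?ler01.
  have := @cut_fun (fun x => (A x)%:R) g 1 d ltr01 d0 A01 gd.
  rewrite mul1r; apply: le_trans.
  rewrite le_eqVlt; apply/orP; left; apply/eqP; congr `|_|; apply: eq_mean => x.
  by rewrite -meanZ; apply: eq_mean => y; ring.
have -> : mean (fun x => `|h x|) =
   mean (fun x => (0 <= h x)%R%:R * h x) - mean (fun x => (h x < 0)%R%:R * h x).
  rewrite -meanB; apply: eq_mean => x; case: (leP 0 (h x)) => h0 /=; rewrite ?mulr1n ?mulr0n.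
    by rewrite ger0_norm //; ring.
  by rewrite ltr0_norm //; ring.
have := H (fun x => 0 <= h x)%R; have := H (fun x => h x < 0)%R.
rewrite !ler_norml; lra.
Qed.

End Cut.

(** * Trees and paths in two kernels close in cut norm *)

Section CutCloseKernels.
Variables (R : realFieldType) (I : Type) (S : I -> finprob R).
Variables (W K : forall i, S i -> S i -> R) (eps : I -> R) (M : R).
Hypothesis W_ge0 : forall i x y, 0 <= @W i x y.
Hypothesis W_sym : forall i x y, @W i x y = @W i y x.
Hypothesis M_gt0 : 0 < M.
Hypothesis K_bnd : forall i x y, 0 <= @K i x y <= M.
Hypothesis K_sym : forall i x y, @K i x y = @K i y x.
Hypothesis cutWK : forall i (A B : pred (S i)),
  `|mean (fun x => mean (fun y => (A x)%:R * (B y)%:R * (W x y - K x y)))| <= eps i.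
Hypothesis degree_moments : moments_bounded (fun i x => mean (@W i x)).

Implicit Types f g h : forall i, S i -> R.

Let K_ge0 i x y : 0 <= @K i x y. Proof. by case/andP: (@K_bnd i x y). Qed.
Let K_le i x y : @K i x y <= M. Proof. by case/andP: (@K_bnd i x y). Qed.
Let M_ge0 : 0 <= M. Proof. exact: ltW. Qed.

Lemma eps_ge0 i : 0 <= eps i.
Proof. exact: le_trans (normr_ge0 _) (@cutWK i pred0 pred0). Qed.

(** Jensen's inequality for the weight U x, from Cauchy-Schwarz by repeated
    squaring. *)
Lemma kernel_op_pow (T : finprob R) (U : T -> T -> R) (f : T -> R) m x :
  (forall x y, 0 <= U x y) -> (forall x, 0 <= f x) ->
  kernel_op U f x ^+ (2 ^ m) <= mean (U x) ^+ (2 ^ m).-1 * kernel_op U (fun y => f y ^+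
    (2 ^ m)) x.
Proof.
move=> U0 f0; elim: m => [|m IH]; first by rewrite expr0 mul1r.
rewrite expnSr exprM.
set q := (2 ^ m)%N in IH *; have q0 : (0 < q)%N by rewrite expn_gt0.
have -> : (q * 2).-1 = (q.-1 * 2).+1 by case: q q0 {IH} => // q _; rewrite mulSn.
apply: (@le_trans _ _ ((mean (U x) ^+ q.-1 * kernel_op U (fun y => f y ^+ q) x) ^+ 2)).
  have o0 : 0 <= kernel_op U (fun y => f y ^+ q) x by apply: kernel_op_ge0 => // ?;
    rewrite exprn_ge0.
  have d0 : 0 <= mean (U x) by apply: mean_ge0.
  by rewrite lerXn2r ?nnegrE ?mulr_ge0 ?exprn_ge0 //; apply: kernel_op_ge0.
rewrite exprMn -exprM [X in _ <= X * _]exprSr -mulrA ler_wpM2l ?exprn_ge0 ?mean_ge0 //.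
apply: le_trans (mean_sqr_le _ _) _ => //.
rewrite le_eqVlt; apply/orP; left; apply/eqP; congr (_ * _).
by apply: eq_mean => y; rewrite -exprM.
Qed.

(** By Jensen the moment of order q of W f is at most a mean over edges xy of
    d(x)^(q-1) f(y)^q, where d is the degree.  Splitting this product into
    squares leaves only functions of a single vertex. *)
Lemma moments_bounded_op f : moments_bounded f ->
  moments_bounded (fun i => kernel_op (@W i) (f i)).
Proof.
move=> hf; have f0 := proj1 hf; split=> [i|m]; first exact: kernel_op_ge0.
set q := (2 ^ m)%N.
have [C hC] := moments_bounded_mean (moments_bounded_mul (moments_bounded_exp
  (q.-1 * 2) degree_moments) degree_moments).
have [C' hC'] := moments_bounded_mean (moments_bounded_mul (moments_bounded_exp
  (q * 2) hf) degree_moments).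
exists (C + C') => i; apply: le_trans (lerD (hC i) (hC' i)).
apply: le_trans (ler_mean (fun x => kernel_op_pow m x (@W_ge0 i) (f0 i))) _.
pose d x := mean (@W i x).
apply: (@le_trans _ _ (mean (fun x => mean (fun y =>
    W x y * (d x ^+ (q.-1 * 2) + f i y ^+ (q * 2)))))).
  apply: ler_mean => x; rewrite -meanZ; apply: ler_mean => y.
  rewrite mulrCA ler_wpM2l ?W_ge0 // !exprM -/(d x).
  set u := _ ^+ _; set v := _ ^+ _.
  have := sqr_ge0 (u - v); have := sqr_ge0 u; have := sqr_ge0 v; nra.
rewrite -(_ : mean (fun x => mean (fun y => W x y * d x ^+ (q.-1 * 2))) +
   mean (fun x => mean (fun y => W x y * f i y ^+ (q * 2))) = mean _); last first.
  rewrite -meanD; apply: eq_mean => x; rewrite -meanD; apply: eq_mean => y.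
  by rewrite mulrDr.
apply: lerD; rewrite le_eqVlt; apply/orP; left; apply/eqP.
  by apply: eq_mean => x; rewrite meanZr mulrC.
rewrite mean_swap; apply: eq_mean => y; rewrite mulrC -meanZr; apply: eq_mean => x.
by rewrite W_sym.
Qed.

Lemma moments_bounded_iter j : moments_bounded (fun i => iter j (kernel_op (@W i)) (fun=> 1)).
Proof. by elim: j => [|j IH]; [exact: moments_bounded_cst|exact: moments_bounded_op]. Qed.

Lemma moments_bounded_tree_eval t : moments_bounded (fun i => tree_eval (@W i) t).
Proof.
elim: t => [|t1 h1 t2 h2|t h]; [exact: moments_bounded_cst|exact:
  moments_bounded_mul|exact: moments_bounded_op].
Qed.

Let Dl i x y := @W i x y - @K i x y.

Lemma DlE i x y : `|@Dl i x y| <= @W i x y + M.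
Proof.
by have := @W_ge0 i x y; have := @K_bnd i x y; rewrite ler_norml /Dl; lra.
Qed.

(** Cut g at level N.  The cut norm handles the bounded part, and the part
    above N is at most g^2 / N, tested against a function at most
    c (degree + M). *)
Lemma edge_vanish g h c : moments_bounded g -> 0 < c -> (forall i x, 0 <= h i x <= c) ->
  vanish eps (fun i => mean (fun x => g i x * kernel_op (@W i) (h i) x)
                     - mean (fun x => g i x * kernel_op (@K i) (h i) x)).
Proof.
move=> hg c0 hc; have g0 := proj1 hg.
have [C hC] := moments_bounded_mean (moments_bounded_mul (moments_bounded_exp 2 hg)
  (moments_bounded_add (moments_bounded_mul (moments_bounded_cst S
    (ltW c0)) degree_moments) (moments_bounded_cst S (mulr_ge0 (ltW c0) M_ge0)))).
apply: (@vanish_trunc _ _ _ _ C) => N N0.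
exists (fun i => N * c * eps i); first by apply: vanish_eps; exact: eps_ge0.
move=> i; pose g1 x := Num.min (g i x) N; pose g2 x := g i x - g1 x.
have -> : mean (fun x => g i x * kernel_op (@W i) (h i) x) -
          mean (fun x => g i x * kernel_op (@K i) (h i) x) =
   mean (fun x => mean (fun y => g1 x * h i y * Dl x y)) +
   mean (fun x => g2 x * mean (fun y => Dl x y * h i y)).
  rewrite -meanB -meanD; apply: eq_mean => x.
  rewrite -!meanZ -meanB -meanD; apply: eq_mean => y.
  by rewrite /g2 /Dl; ring.
apply: le_trans (ler_normD _ _) _; apply: lerD.
  apply: (cut_fun (@cutWK i)) => // x.
  by rewrite /g1 le_min ge_min g0 lexx (ltW N0) orbT.
have g2g x : 0 <= g2 x <= g i x ^+ 2 / N.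
  rewrite /g2 /g1; case: (leP (g i x) N) => gN.
    by rewrite subrr lexx divr_ge0 ?sqr_ge0 ?(ltW N0).
  have := g0 i x; rewrite subr_ge0 (ltW gN) ler_pdivlMr //=.
  by move: (g i x) gN => u gN u0; nra.
apply: le_trans (ler_norm_mean _) _; apply: le_trans (ler_wpM2r _ (hC i)).
  2: by rewrite invr_ge0 ltW.
rewrite -meanZr; apply: ler_mean => x.
rewrite normrM mulrAC; have /andP[g20 g2N] := g2g x; rewrite (ger0_norm g20).
apply: ler_pM => //; apply: le_trans (ler_norm_mean _) _.
rewrite -meanZ -(mean_cst (S i) (c * M)) -meanD; apply: ler_mean => y.
rewrite normrM -mulrDr mulrC; have /andP[h0 hcy] := hc i y.
by rewrite (ger0_norm h0) ler_pM ?DlE.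
Qed.

Lemma moments_bounded_mulb g h c : moments_bounded g -> 0 <= c ->
  (forall i x, 0 <= h i x <= c) ->
  moments_bounded (fun i x => g i x * h i x).
Proof.
move=> hg c0 hc; apply: moments_bounded_le (moments_bounded_mul hg
  (moments_bounded_cst S c0)) _ => i x.
have := proj1 hg i x; have /andP[h0 hcx] := hc i x => g0.
by rewrite mulr_ge0 // ler_wpM2l.
Qed.

Lemma tree_bound_gt0 t : 0 < tree_bound M t.
Proof. by elim: t => [|t1 h1 t2 h2|t h] //=; rewrite mulr_gt0. Qed.

Lemma tree_eval_bnd t i x : 0 <= tree_eval (@K i) t x <= tree_bound M t.
Proof. by rewrite tree_eval_ge0 // tree_eval_le. Qed.

(** The test function g at the root makes the induction work: gluing moves one
    factor into it, hanging moves the kernel operator into it by symmetry.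
    What has already been replaced by K is bounded, so that a single edge
    remains to be changed. *)
Lemma tree_vanish t g : moments_bounded g ->
  vanish eps (fun i => mean (fun x => g i x * tree_eval (@W i) t x)
                     - mean (fun x => g i x * tree_eval (@K i) t x)).
Proof.
elim: t g => [|t1 IH1 t2 IH2|t IH] g hg.
- move=> eta e0; exists 1 => // i _; rewrite subrr normr0; exact: ltW.
- have h1 := IH1 _ (moments_bounded_mul hg (moments_bounded_tree_eval t2)).
  have h2 := IH2 _ (moments_bounded_mulb hg (ltW (tree_bound_gt0 t1)) (tree_eval_bnd t1)).
  apply: eq_vanish (vanishD h1 h2) => i /=.
  rewrite -!meanB -meanD; apply: eq_mean => x; ring.
- have h1 := IH _ (moments_bounded_op hg).
  have h2 := edge_vanish hg (tree_bound_gt0 t) (tree_eval_bnd t).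
  apply: eq_vanish (vanishD h1 h2) => i /=.
  by rewrite -!kernel_op_adj //; ring.
Qed.

Lemma tree_counting t :
  vanish eps (fun i => mean (tree_eval (@W i) t) - mean (tree_eval (@K i) t)).
Proof.
apply: eq_vanish (tree_vanish t (moments_bounded_cst S ler01)) => i.
by congr (_ - _); apply: eq_mean => x; rewrite mul1r.
Qed.

Notation S2 := (fun i => prod_prob (S i) (S i)).
Notation mean2 f := (mean (fun x => mean (f x))).

Lemma moments_bounded_snd f : moments_bounded f -> moments_bounded (S :=
  S2) (fun i z => f i z.2).
Proof.
move=> [f0 hf]; split=> [i [x y]|m]; first exact: f0.
have [C hC] := hf m; exists C => i.
by rewrite (mean_prod (fun x y => f i y ^+ (2 ^ m))) mean_cst.
Qed.

(** A bounded factor K at one end of the path is enough for L1 convergence, with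
    no lower bound on the length.  Peel off the last edge: the error of the
    shorter path is multiplied by the degree, which has bounded moments, and
    the last edge itself is tested against a bounded function. *)
Lemma comp_path_kernel_vanish j : vanish eps (fun i =>
  mean2 (fun x y => `|kernel_comp (@K i) (path_kernel (@W i) j) x y - path_kernel
    (@K i) j.+1 x y|)).
Proof.
have last_edge (f : forall i, S i -> S i -> R) c : 0 < c ->
    (forall i x y, 0 <= f i x y <= c) ->
    vanish eps (fun i => mean2 (fun x y => `|mean (fun z => f i x z * Dl z y)|)).
  move=> c0 fc; apply: vanish_le (vanish_eps (2 * c) eps_ge0) _ => i.
  rewrite ger0_norm; last by apply: mean_ge0 => x; apply: mean_ge0.
  rewrite -[X in _ <= X](mean_cst (S i)); apply: ler_mean => x.
  have := cut_L1 (@cutWK i) c0 (fc i x); apply: le_trans.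
  apply: ler_mean => y; rewrite le_eqVlt; apply/orP; left; apply/eqP; congr `|_|.
  by apply: eq_mean => z; rewrite /Dl W_sym K_sym mulrC.
elim: j => [|j IH].
  apply: eq_vanish (last_edge _ _ M_gt0 (@K_bnd)) => i.
  apply: eq_mean => x; apply: eq_mean => y; congr `|_|; rewrite -meanB.
  by apply: eq_mean => z; rewrite /Dl mulrBr.
pose a i x y := kernel_comp (@K i) (path_kernel (@W i) j) x y - path_kernel (@K i) j.+1 x y.
have Mj : 0 < M ^+ j.+2 by rewrite exprn_gt0.
have PKM i x y : 0 <= path_kernel (@K i) j.+1 x y <= M ^+ j.+2.
  by rewrite path_kernel_ge0 // path_kernel_le.
have PWs i := path_kernel_sym j (@W_sym i).
have KW0 i x y : 0 <= kernel_comp (@K i) (path_kernel (@W i) j) x y.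
  by apply: mean_ge0 => z; rewrite mulr_ge0 ?path_kernel_ge0.
have ab i (z : S2 i) : `|a i z.1 z.2| <=
    M * iter j.+1 (kernel_op (@W i)) (fun=> 1) z.2 + M ^+ j.+2.
  case: z => x y /=.
  have KWb : kernel_comp (@K i) (path_kernel (@W i) j) x y <=
    M * iter j.+1 (kernel_op (@W i)) (fun=> 1) y.
    rewrite -mean_path_kernel -meanZ; apply: ler_mean => z.
    by rewrite (PWs i y) ler_wpM2r ?path_kernel_ge0.
  by have := PKM i x y; have := KW0 i x y; rewrite /a ler_norml; move: KWb => /=; lra.
have V1 : vanish eps (fun i => mean (S := S2 i) (fun z => `|a i z.1 z.2|)).
  by apply: eq_vanish IH => i; rewrite -(mean_prod (fun x y => `|a i x y|)).
have hbnd : moments_bounded (S := S2) (fun i z => M * iter j.+1 (kernel_op (@W i))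
  (fun=> 1) z.2 + M ^+ j.+2).
  apply: moments_bounded_add; last exact: moments_bounded_cst (ltW Mj).
  by apply: moments_bounded_mul; [exact: moments_bounded_cst|exact:
    moments_bounded_snd (moments_bounded_iter j.+1)].
have V2 := vanish_mul_moments_bounded hbnd (moments_bounded_snd degree_moments) ab V1.
have V3 := last_edge _ _ Mj PKM.
apply: vanish_le (vanishD V2 V3) _ => i.
rewrite ger0_norm; last by apply: mean_ge0 => x; apply: mean_ge0.
rewrite (mean_prod (fun x y => `|a i x y| * mean (@W i y))) -meanD.
apply: ler_mean => x.
have -> : mean (fun y => `|a i x y| * mean (@W i y)) =
          mean (fun y => mean (fun u => `|a i x u| * W u y)).
  by rewrite mean_swap; apply: eq_mean => y; rewrite meanZ.
rewrite -meanD; apply: ler_mean => y.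
have -> : kernel_comp (@K i) (path_kernel (@W i) j.+1) x y - path_kernel (@K i) j.+2 x y =
   mean (fun u => a i x u * W u y) + mean (fun u => path_kernel (@K i) j.+1 x u * Dl u y).
  rewrite [path_kernel _ j.+2 _ _]path_kernelSr.
  rewrite (@eq_kernel_comp _ _ _ _ _ _ (fun _ _ => erefl)
    (path_kernelSr (@W i) j)) kernel_compA.
  rewrite -meanB -meanD; apply: eq_mean => u; rewrite /a /Dl; ring.
apply: le_trans (ler_normD _ _) _; rewrite lerD2r.
apply: le_trans (ler_norm_mean _) _; apply: ler_mean => u.
by rewrite normrM (ger0_norm (W_ge0 _ _)).
Qed.

(** Write the difference as (W - K) o Q + K o (Q - Q'), where Q and Q' are the
    path kernels of W and K with d inner vertices.  The second term is
    comp_path_kernel_vanish.  In the first, Q may be truncated since it is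
    bounded in L2; the tail is weighted by the degree, which also has to be
    compared with the truncation level. *)
Lemma path_kernel_vanish d :
  (exists C, forall i, mean2 (fun x y => path_kernel (@W i) d x y ^+ 2) <= C) ->
  vanish eps (fun i => mean2 (fun x y => `|path_kernel (@W i) d.+1 x y - path_kernel
    (@K i) d.+1 x y|)).
Proof.
move=> [C hC]; pose Q i := path_kernel (@W i) d.
have Q0 i x y : 0 <= Q i x y by apply: path_kernel_ge0.
pose b i x := mean (@W i x) + M.
have hb : moments_bounded b by apply: moments_bounded_add => //; exact: moments_bounded_cst.
have b0 := proj1 hb.
have [C' hC'] := moments_bounded_mean (moments_bounded_mul (moments_bounded_iter d.+1)
  (moments_bounded_exp 2 hb)).
have V : vanish eps (fun i => mean2 (fun x y => `|mean (fun z => Dl x z * Q i z y)|)).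
  apply: (@vanish_trunc _ _ _ _ (C + C')) => N N0; have N20 : 0 < N ^+ 2 by rewrite exprn_gt0.
  exists (fun i => 2 * N ^+ 2 * eps i); first by apply: vanish_eps; exact: eps_ge0.
  move=> i; rewrite ger0_norm; last by apply: mean_ge0 => x; apply: mean_ge0.
  (* The level is N^2 because b Q <= (Q^2 + Q b^2) / N as soon as Q >= N^2:
     either b <= N <= Q / N, or b >= N. *)
  pose Q1 z y := Num.min (Q i z y) (N ^+ 2); pose Q2 z y := Q i z y - Q1 z y.
  have Q20 z y : 0 <= Q2 z y by rewrite subr_ge0 ge_min lexx.
  have bQ2 z y : b i z * Q2 z y <= (Q i z y ^+ 2 + Q i z y * b i z ^+ 2) / N.
    rewrite /Q2 /Q1; move: (Q0 i z y) (b0 i z); set u := Q i z y; set v := b i z => u0 v0.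
    have r0 : 0 <= (u ^+ 2 + u * v ^+ 2) / N.
      by rewrite divr_ge0 ?(ltW N0) ?addr_ge0 ?mulr_ge0 ?sqr_ge0.
    case: (leP u (N ^+ 2)) => uN; first by rewrite subrr mulr0.
    rewrite ler_pdivlMr //.
    apply: (@le_trans _ _ (v * u * N)).
      rewrite ler_wpM2r ?(ltW N0) // ler_wpM2l // lerBlDr lerDl; exact: ltW.
    have [vN|Nv] := leP v N.
      apply: (@le_trans _ _ (u ^+ 2)); last by rewrite lerDl mulr_ge0 ?sqr_ge0.
      rewrite mulrAC mulrC expr2 ler_wpM2l //; apply: le_trans (ltW uN).
      by rewrite expr2 ler_wpM2r ?(ltW N0).
    apply: (@le_trans _ _ (u * v ^+ 2)); last by rewrite lerDr sqr_ge0.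
    by rewrite mulrAC mulrC ler_wpM2l // expr2 ler_wpM2l // ltW.
  apply: (@le_trans _ _ (mean2 (fun x y => `|mean (fun z => Dl x z * Q1 z y)|) +
     mean2 (fun x y => mean (fun z => (W x z + M) * Q2 z y)))).
    rewrite -meanD; apply: ler_mean => x; rewrite -meanD; apply: ler_mean => y.
    apply: le_trans (_ : `|mean (fun z => Dl x z * Q1 z y)| + `|mean
      (fun z => Dl x z * Q2 z y)| <= _).
      apply: le_trans (ler_normD _ _); rewrite -meanD le_eqVlt; apply/orP; left.
      by apply/eqP; congr `|_|; apply: eq_mean => z; rewrite /Q2; ring.
    rewrite lerD2l; apply: le_trans (ler_norm_mean _) _; apply: ler_mean => z.
    by rewrite normrM (ger0_norm (Q20 _ _)) ler_wpM2r ?DlE.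
  apply: lerD.
    rewrite mean_swap -[X in _ <= X](mean_cst (S i)); apply: ler_mean => y.
    apply: (cut_L1 (@cutWK i)) => // z; by rewrite /Q1 le_min ge_min Q0 lexx (ltW N20) orbT.
  have -> : mean2 (fun x y => mean (fun z => (W x z + M) * Q2 z y)) =
            mean2 (fun z y => b i z * Q2 z y).
    rewrite mean_swap [RHS]mean_swap; apply: eq_mean => y.
    rewrite mean_swap; apply: eq_mean => z; rewrite meanZr; congr (_ * _).
    rewrite meanD mean_cst /b; congr (_ + _); apply: eq_mean => x; exact: W_sym.
  apply: (@le_trans _ _ ((mean2 (fun z y => Q i z y ^+ 2) +
     mean2 (fun z y => Q i z y * b i z ^+ 2)) / N)).
    rewrite -meanD -meanZr; apply: ler_mean => z; rewrite -meanD -meanZr.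
    by apply: ler_mean => y.
  rewrite ler_wpM2r ?invr_ge0 ?(ltW N0) // lerD ?hC //.
  apply: le_trans (hC' i); apply: ler_mean => z; rewrite meanZr.
  by rewrite /Q mean_path_kernel.
apply: vanish_le (vanishD V (comp_path_kernel_vanish d)) _ => i.
rewrite ger0_norm; last by apply: mean_ge0 => x; apply: mean_ge0.
rewrite -meanD; apply: ler_mean => x; rewrite -meanD; apply: ler_mean => y.
apply: le_trans (ler_normD _ _); rewrite le_eqVlt; apply/orP; left; apply/eqP.
congr `|_|; rewrite addrA; congr (_ - _).
by rewrite -meanD; apply: eq_mean => z /=; rewrite /Dl /Q mulrBl subrK.
Qed.

End CutCloseKernels.

(** * Powers of a finite weighted space *)

Section Power.
Variables (R : realFieldType) (V : finType).
Implicit Types S T : finprob R.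

Lemma pow_wt_ge0 S (x : {ffun V -> S}) : 0 <= \prod_v wt (x v).
Proof. by apply: prodr_ge0 => v _; exact: wt_ge0. Qed.

Lemma pow_wt_sum S : \sum_(x : {ffun V -> S}) \prod_v wt (x v) = 1.
Proof.
rewrite -(bigA_distr_bigA (fun (v : V) (s : S) => wt s)).
by rewrite big1 // => v _; exact: wt_sum.
Qed.

Definition pow_prob S : finprob R :=
  @FinProb R {ffun V -> S} _ (@pow_wt_ge0 S) (pow_wt_sum S).

Lemma mean_pow_prod S (f : V -> S -> R) :
  mean (S := pow_prob S) (fun x => \prod_v f v (x v)) = \prod_v mean (f v).
Proof.
rewrite /mean bigA_distr_bigA /=; apply: eq_bigr => x _.
by rewrite -big_split.
Qed.

Definition update S (x : {ffun V -> S}) v z : {ffun V -> S} :=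
  [ffun u => if u == v then z else x u].

(** The map exchanging z with the coordinate of x at v preserves the weight of
    (x, z). *)
Lemma mean_resample S v (f : {ffun V -> S} -> R) :
  mean (S := pow_prob S) f = mean (S := pow_prob S) (fun x => mean (fun z => f (update x v z))).
Proof.
pose w (x : {ffun V -> S}) : R := \prod_u wt (x u).
pose sw (xz : {ffun V -> S} * S) := (update xz.1 v xz.2, xz.1 v).
have swK : involutive sw.
  move=> [x z]; rewrite /sw /= ffunE eqxx; congr (_, _); apply/ffunP => u.
  by rewrite !ffunE; case: eqP => [->|].
have wE xz : w (sw xz).1 * wt (sw xz).2 = w xz.1 * wt xz.2.
  case: xz => x z; rewrite /sw /w /= (bigD1 v) //= [in RHS](bigD1 v) //= ffunE eqxx.
  rewrite (eq_bigr (fun u => wt (x u))); first by ring.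
  by move=> u /negPf uv; rewrite ffunE uv.
transitivity (\sum_(xz : {ffun V -> S} * S) w xz.1 * wt xz.2 * f xz.1).
  rewrite -(pair_bigA _ (fun (x : {ffun V -> S}) (z : S) => w x * wt z * f x)) /=.
  apply: eq_bigr => x _; rewrite -mulr_suml; congr (_ * _).
  by rewrite -mulr_sumr wt_sum mulr1.
rewrite (reindex_inj (inv_inj swK)) /=.
under eq_bigr do rewrite wE.
rewrite -(pair_bigA _ (fun (x : {ffun V -> S}) (z : S) => w x * wt z * f (update x v z))) /=.
apply: eq_bigr => x _; rewrite /mean mulr_sumr; apply: eq_bigr => z _.
by rewrite mulrA.
Qed.

Lemma mean_single S v (h : S -> R) :
  mean (S := pow_prob S) (fun x => h (x v)) = mean h.
Proof.
rewrite (mean_resample v) -[RHS](mean_cst (pow_prob S)); apply: eq_mean => x.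
by apply: eq_mean => z; rewrite ffunE eqxx.
Qed.

Lemma mean_pair S u v (h : S -> S -> R) : u != v ->
  mean (S := pow_prob S) (fun x => h (x u) (x v)) = mean (fun s => mean (h s)).
Proof.
move=> uv; rewrite (mean_resample v).
rewrite -(mean_single u (fun s => mean (h s))); apply: eq_mean => x.
by apply: eq_mean => z; rewrite !ffunE eqxx (negPf uv).
Qed.

Lemma mean_push S T (phi : S -> T) (H : {ffun V -> T} -> R) :
  (forall t, \sum_(s | phi s == t) wt s = wt t) ->
  mean (S := pow_prob S) (fun x => H [ffun v => phi (x v)]) = mean (S := pow_prob T) H.
Proof.
move=> hphi; rewrite /mean (partition_big (fun x : {ffun V ->
  S} => [ffun v => phi (x v)]) xpredT) //=.
apply: eq_bigr => y _; under eq_bigr => x /eqP -> do [].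
rewrite -mulr_suml; congr (_ * _).
under [RHS]eq_bigr do rewrite -hphi.
rewrite bigA_distr_big_dep; apply: eq_bigl => x.
apply/eqP/familyP => [<- v|h]; first by rewrite unfold_in ffunE.
by apply/ffunP => v; rewrite ffunE; apply/eqP; have := h v; rewrite unfold_in.
Qed.

End Power.

(** * Homomorphism densities and decompositions into paths *)

Section Orientation.
Variables (R : realFieldType) (V : finType) (T : Type) (U : T -> T -> R).
Hypothesis U_sym : forall s t, U s t = U t s.

Definition orient_prod (F o : rel V) (x : V -> T) :=
  \prod_(z : V * V | F z.1 z.2 && o z.1 z.2) U (x z.1) (x z.2).

Definition orientation (F o : rel V) := forall x y, F x y -> o x y = ~~ o y x.

(** Two orientations agree up to reversing edges, which U does not see. *)
Lemma orient_prod_eq F o o' x : symmetric F -> orientation F o -> orientation F o' ->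
  orient_prod F o x = orient_prod F o' x.
Proof.
move=> sF ho ho'; rewrite /orient_prod.
rewrite (bigID (fun z => o' z.1 z.2)) [RHS](bigID (fun z => o z.1 z.2)) /=; congr (_ * _).
  by apply: eq_bigl => z; rewrite andbAC.
have sw_inj : injective (fun z : V * V => (z.2, z.1)) by move=> [? ?] [? ?] [-> ->].
rewrite (reindex_inj sw_inj) /=; apply: eq_big => [[a b]|[a b] _] /=; last by rewrite U_sym.
rewrite sF; case Fab: (F a b) => //=; rewrite (ho _ _ Fab) (ho' _ _ Fab) negbK.
by rewrite andbC.
Qed.

End Orientation.

Section Paths.
Variables (V E : finType) (F : rel V) (d : E -> nat) (pi : E -> nat -> V).

(** A decomposition of F into paths with vertices pi e 0, ..., pi e (d e + 1).
    Since i' may be 0 or d e' + 1 in ps_inner, an inner vertex lies on no other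
    path, not even as an end.  This form covers subdivisions of multigraphs as
    well as an even cycle seen as two paths. *)
Record path_system : Prop := PathSystem {
  ps_pos : forall e, (0 < d e)%N;
  ps_inner : forall e i e' i', (0 < i <= d e)%N -> (i' <= (d e').+1)%N ->
    pi e i = pi e' i' -> e = e' /\ i = i';
  ps_ends : forall e, pi e 0 != pi e (d e).+1;
  ps_edge : forall x y, F x y <-> exists e, exists2 i, (i <= d e)%N &
    (x, y) = (pi e i, pi e i.+1) \/ (y, x) = (pi e i, pi e i.+1) }.

Hypothesis ps : path_system.

Lemma path_edge_inj e i e' i' : (i <= d e)%N -> (i' <= d e')%N ->
  pi e i = pi e' i' -> pi e i.+1 = pi e' i'.+1 -> e = e' /\ i = i'.
Proof.
case: i => [|i] hi hi' E1 E2; last by apply: (ps_inner ps) E1 => //; exact: leqW.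
have [//| -> /succn_inj ->] := ps_inner ps (e' := e') (i' := i'.+1) _ hi' E2.
  by rewrite (ps_pos ps).
by [].
Qed.

Lemma path_edge_asym e i e' i' : (i <= d e)%N -> (i' <= d e')%N ->
  pi e i = pi e' i'.+1 -> pi e i.+1 = pi e' i' -> False.
Proof.
(* The only subtle case is d f = 1, where positions 0 and 2 are the ends. *)
have D2 f : pi f 0 <> pi f 2.
  move=> E0; have := ps_pos ps f; rewrite leq_eqVlt => /orP[/eqP df|df].
    by have := ps_ends ps f; rewrite -df E0 eqxx.
  by have [] := ps_inner ps (e := f) (i := 2) (e' := f) (i' := 0) df isT (esym E0).
move=> hi hi' E1 E2.
have [i0|i0] := posnP i.
  subst i.
  have [| |ee i1] := ps_inner ps (e := e) (i := 1) _ _ E2.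
  - by rewrite (ps_pos ps).
  - exact: leqW.
  by move: E1; rewrite -ee -i1; exact: D2.
have [| |ee ii] := ps_inner ps (e := e) (i := i) _ _ E1.
- by rewrite i0.
- by [].
subst e' i.
have := hi; rewrite leq_eqVlt => /orP[/eqP id|id]; last first.
  have [| |_] := ps_inner ps (e := e) (i := i'.+2) _ _ E2.
  - by [].
  - by apply: leqW; apply: ltnW.
  by move/eqP; rewrite -addn2 -[X in _ == X]addn0 eqn_add2l.
have [i'0|i'0] := posnP i'; first by move: E2; rewrite i'0 => /esym; exact: D2.
have [| |_] := ps_inner ps (e := e) (i := i') _ _ (esym E2).
- by rewrite i'0 ltnW.
- by rewrite ltnS.
by move/eqP; rewrite -addn2 -[X in X == _]addn0 eqn_add2l.
Qed.

Let P := {e : E & 'I_(d e).+1}.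
Let phi (p : P) := (pi (tag p) (tagged p), pi (tag p) (tagged p).+1).

Let phi_inj : injective phi.
Proof.
move=> [e i] [e' i'] [/= E1 E2].
have [ee ii] := path_edge_inj (ltn_ord i) (ltn_ord i') E1 E2.
by subst e'; rewrite (val_inj ii).
Qed.

Let o x y := [exists p, (x, y) == phi p].

Lemma path_orientation : orientation F o.
Proof.
have no_both x y : o x y -> o y x -> False.
  move=> /existsP[[e i] /eqP[-> ->]] /existsP[[e' i'] /eqP[E1 E2]].
  exact: (path_edge_asym (ltn_ord i) (ltn_ord i')) E2 E1.
move=> x y /(ps_edge ps)[e [i hi h]].
have {}h : o x y || o y x.
  have hi' : (i < (d e).+1)%N by [].
  by case: h => h; apply/orP; [left|right]; apply/existsP;
    exists (existT _ e (Ordinal hi')); rewrite h.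
case oyx: (o y x); last by move: h; rewrite oyx orbF => ->.
by apply/negbTE/negP => oxy; exact: no_both oxy oyx.
Qed.

Lemma orient_prod_paths (R : realFieldType) (T : Type) (U : T -> T -> R) x :
  orient_prod U F o x =
    \prod_e \prod_(0 <= i < (d e).+1) U (x (pi e i)) (x (pi e i.+1)).
Proof.
under [RHS]eq_bigr do rewrite big_mkord.
rewrite sig_big_dep /= /orient_prod.
pose G (z : V * V) := U (x z.1) (x z.2).
rewrite -[RHS](big_map phi xpredT G) -[LHS]big_filter; apply: perm_big.
apply: uniq_perm; rewrite ?map_inj_uniq ?filter_uniq ?index_enum_uniq //.
move=> [a b]; rewrite mem_filter mem_index_enum andbT /=; apply/andP/mapP.
  by move=> [_ /existsP[p /eqP ->]]; exists p; rewrite ?mem_index_enum.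
move=> [p _ abp]; split; last by apply/existsP; exists p; apply/eqP.
apply/(ps_edge ps); exists (tag p), (tagged p); last by left.
by rewrite -ltnS.
Qed.

Section Integrate.
Variables (R : realFieldType) (S : finprob R) (U : S -> S -> R).

(* In Q m the first m e inner vertices of each path e are integrated out. *)
Let Q (m : E -> nat) (x : V -> S) := \prod_e (path_kernel U (m e) (x (pi e 0))
  (x (pi e (m e).+1)) *
   \prod_((m e).+1 <= i < (d e).+1) U (x (pi e i)) (x (pi e i.+1))).

(** The next inner vertex of the path e0 occurs in two factors only, and
    integrating it out lengthens the path kernel by one edge. *)
Lemma mean_path_step (m m' : E -> nat) e0 : (m e0 < d e0)%N ->
  (forall e, m e <= d e)%N -> (forall e, m' e = m e + (e == e0))%N ->
  mean (S := pow_prob V S) (fun x => Q m x) = mean (S := pow_prob V S) (fun x => Q m' x).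
Proof.
move=> m0 md m'E; set j := m e0 in m0; pose v := pi e0 j.+1.
have jin : (0 < j.+1 <= d e0)%N by [].
have updE (x : {ffun V -> S}) z e i : (i <= (d e).+1)%N -> (e, i) != (e0, j.+1) ->
    update x v z (pi e i) = x (pi e i).
  move=> id ne; rewrite ffunE; case: eqP => // Ev.
  have [e0e ji] := ps_inner ps jin id (esym Ev).
  by move: ne; rewrite -e0e -ji eqxx.
rewrite (mean_resample v); apply: eq_mean => x.
transitivity (mean (fun z => (\prod_(e | e != e0) (path_kernel U (m e) (x (pi e 0))
  (x (pi e (m e).+1)) *
   \prod_((m e).+1 <= i < (d e).+1) U (x (pi e i)) (x (pi e i.+1)))) *
   ((path_kernel U j (x (pi e0 0)) z * U z (x (pi e0 j.+2))) *
   \prod_(j.+2 <= i < (d e0).+1) U (x (pi e0 i)) (x (pi e0 i.+1))))).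
  apply: eq_mean => z; rewrite /Q (bigD1 e0) //= mulrC; congr (_ * _).
    apply: eq_bigr => e /negPf ne; have me := md e.
    rewrite !updE ?ltnS // ?xpair_eqE ?ne //.
    congr (_ * _); rewrite big_nat [RHS]big_nat; apply: eq_bigr => i /andP[_ id].
    by rewrite !updE ?xpair_eqE ?ne // ltnW.
  have -> : update x v z (pi e0 (m e0).+1) = z by rewrite ffunE eqxx.
  rewrite -/j big_ltn ?ltnS // mulrA.
  have -> : update x v z (pi e0 j.+1) = z by rewrite ffunE eqxx.
  rewrite (updE x z e0 0%N) ?xpair_eqE ?eqxx //.
  rewrite (updE x z e0 j.+2) ?xpair_eqE ?eqxx /= ?gtn_eqF //; congr (_ * _).
  rewrite big_nat [RHS]big_nat; apply: eq_bigr => i /andP[ji id].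
  by rewrite !updE ?xpair_eqE ?eqxx //= ?gtn_eqF // ltnW.
rewrite meanZ meanZr [RHS](bigD1 e0) //= [RHS]mulrC; congr (_ * _).
  apply: eq_bigr => e /negPf ne; by rewrite m'E ne addn0.
by rewrite m'E eqxx addn1 -/j path_kernelSr.
Qed.

Lemma mean_paths :
  mean (S := pow_prob V S) (fun x =>
    \prod_e \prod_(0 <= i < (d e).+1) U (x (pi e i)) (x (pi e i.+1))) =
  mean (S := pow_prob V S) (fun x => \prod_e path_kernel U (d e) (x (pi e 0))
    (x (pi e (d e).+1))).
Proof.
have H N m : \sum_e m e = N -> (forall e, m e <= d e)%N ->
    mean (S := pow_prob V S) (fun x => Q (fun=> 0%N) x) =
    mean (S := pow_prob V S) (fun x => Q m x).
  elim: N m => [|N IH] m mN md.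
    apply: eq_mean => x; apply: eq_bigr => e _.
    by have /eqP -> : m e == 0%N by move/eqP: mN; rewrite sum_nat_eq0 => /forallP/(_ e).
  have [e0 me0] : exists e0, (0 < m e0)%N.
    apply/existsP; apply: contraPT mN; rewrite negb_exists => /forallP h.
    by rewrite big1 // => e _; apply/eqP; have := h e; rewrite -eqn0Ngt.
  pose m1 e := (m e - (e == e0))%N.
  have m1E e : m e = (m1 e + (e == e0))%N.
    by rewrite /m1; case: eqP => [->|_]; rewrite ?subn0 ?addn0 // subnK.
  rewrite -(@mean_path_step m1 m e0) //.
  - apply: IH; last by move=> e; apply: leq_trans (md e); rewrite leq_subr.
    apply: succn_inj; rewrite -mN -[LHS]addn1.
    under [RHS]eq_bigr do rewrite m1E; rewrite big_split /=; congr (_ + _)%N.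
    rewrite (bigD1 e0) //= eqxx big1 // => e /negPf -> //.
  - by rewrite /m1 eqxx subn1 prednK // -ltnS prednK.
  - by move=> e; apply: leq_trans (md e); rewrite leq_subr.
transitivity (mean (S := pow_prob V S) (fun x => Q (fun=> 0%N) x)).
  apply: eq_mean => x; apply: eq_bigr => e _.
  by rewrite big_ltn.
rewrite (H _ d erefl) //; apply: eq_mean => x; apply: eq_bigr => e _.
by rewrite big_geq // mulr1.
Qed.

End Integrate.
End Paths.

(** The product is laid out as in hom_integral, so that the two agree for step
    kernels without reindexing. *)
Definition hom_mean (R : realFieldType) (S : finprob R) (U : S -> S -> R)
    (k : nat) (F : sgraph 'I_k) : R :=
  mean (S := pow_prob 'I_k S) (fun x =>
    \prod_(i < k) \prod_(j < k | (i < j)%N && F i j) U (x i) (x j)).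

Lemma lt_orientation k (F : sgraph 'I_k) : orientation F (fun i j : 'I_k => (i < j)%N).
Proof.
by move=> i j Fij; rewrite -leqNgt ltn_neqAle; case: eqVneq Fij => // /ord_inj ->;
  rewrite adj_irrefl.
Qed.

Lemma hom_prodE (R : realFieldType) (T : Type) (U : T -> T -> R) k (F : sgraph 'I_k) x :
  \prod_(i < k) \prod_(j < k | (i < j)%N && F i j) U (x i) (x j) =
  orient_prod U F (fun i j : 'I_k => (i < j)%N) x.
Proof.
by rewrite pair_big_dep /orient_prod; apply: eq_bigl => z /=; rewrite andbC.
Qed.

Lemma hom_mean_paths (R : realFieldType) (S : finprob R) (U : S -> S -> R)
    k (F : sgraph 'I_k) (E : finType) (d : E -> nat) pi :
  (forall x y, U x y = U y x) -> path_system F d pi ->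
  hom_mean U F =
  mean (S := pow_prob 'I_k S) (fun x => \prod_e path_kernel U (d e) (x (pi e 0))
    (x (pi e (d e).+1))).
Proof.
move=> U_sym ps; rewrite -(mean_paths ps); apply: eq_mean => x.
rewrite hom_prodE -(orient_prod_paths ps); apply: orient_prod_eq => //.
- exact: adj_sym.
- exact: lt_orientation.
- exact: path_orientation ps.
Qed.

(** * Subdivisions, theta graphs and even cycles *)

Section SubdivisionPaths.
Variables (M : multigraph) (d : medge M -> nat).

Let code (v : subdiv_vertex d) : option (medge M * nat) :=
  if v is inr p then Some (tag p, val (tagged p)) else None.

Let code_path e i :
  code (subdiv_path d e i) = if (0 < i <= d e)%N then Some (e, i.-1) else None.
Proof.
case: i => [|i] //=; case: insubP => [j ij vj|/negPf ->] //=.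
by rewrite ij vj.
Qed.

Lemma subdiv_path_system (V : finType) (F : rel V) (phi : V -> subdiv_vertex d) psi :
  (forall e, 0 < d e)%N -> cancel phi psi -> cancel psi phi ->
  (forall x y, subdiv_adj (phi x) (phi y) = F x y) ->
  path_system F d (fun e i => psi (subdiv_path d e i)).
Proof.
move=> d0 phiK psiK hF; split=> //.
- move=> e i e' i' ide id'e /(can_inj psiK)/(congr1 code).
  rewrite !code_path ide; case: ifP => // /andP[i'0 _] [-> ii]; split=> //.
  by have /andP[i0 _] := ide; rewrite -(prednK i0) ii prednK.
- move=> e; rewrite (can_eq psiK) /=; case: insubP => [j|_]; first by rewrite ltnn.
  by apply: contra (mloopless e) => /eqP[->].
- move=> x y; rewrite -hF; split.
    move=> /existsP[e /existsP[i h]]; exists e, i; first by rewrite -ltnS.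
    by case/orP: h => /andP[/eqP h1 /eqP h2]; [left|right]; rewrite -h1 -h2 !phiK.
  move=> [e [i hi h]]; apply/existsP; exists e; apply/existsP.
  have hi' : (i < (d e).+1)%N by []; exists (Ordinal hi') => /=.
  by case: h => -[-> ->]; rewrite !psiK !eqxx ?orbT.
Qed.

Lemma subdiv_adj_sym : symmetric (@subdiv_adj M d).
Proof.
by move=> x y; apply/existsP/existsP => -[e /existsP[i h]]; exists e;
  apply/existsP; exists i; rewrite orbC.
Qed.

Lemma subdiv_adj_irrefl : (forall e, 0 < d e)%N -> irreflexive (@subdiv_adj M d).
Proof.
move=> d0 x; apply/negbTE/negP => /existsP[e /existsP[i]]; rewrite orbb.
move=> /andP[/eqP -> /eqP/(congr1 code)]; rewrite !code_path.
have := ltn_ord i; rewrite ltnS => id; rewrite id andbT /=.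
have [i0|i0] := posnP i; first by rewrite i0 d0.
case: ifP => // _ [/eqP]; rewrite -[X in _ == X](prednK i0).
by rewrite ltn_eqF.
Qed.

End SubdivisionPaths.

Lemma in_Fge_paths l k (F : sgraph 'I_k) : (1 < l)%N -> in_Fge l F ->
  exists (E : finType) (d : E -> nat) pi,
    path_system F d pi /\ forall e, (l.-1 <= d e)%N.
Proof.
move=> l1 [M [d [ld [phi [psi phiK psiK] hphi]]]].
exists (medge M), d, (fun e i => psi (subdiv_path d e i)); split=> //.
apply: (subdiv_path_system (phi := phi)) => // e.
by apply: leq_trans (ld e); rewrite -ltnS prednK // ltnW.
Qed.

(** The theta graph with q paths of d inner vertices: the moments of the path
    kernel are densities of graphs to which the hypotheses apply. *)
Lemma theta_graph l q d : (l.-1 <= d)%N -> (0 < d)%N ->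
  exists k (F : sgraph 'I_k), in_Fge l F /\
    forall (R : realFieldType) (S : finprob R) (U : S -> S -> R),
    (forall x y, U x y = U y x) ->
    hom_mean U F = mean (fun x => mean (fun y => path_kernel U d x y ^+ q)).
Proof.
move=> ld d0.
have noloop (e : 'I_q) : (false, true).1 != (false, true).2 by [].
pose M := @MultiGraph bool 'I_q (fun=> (false, true)) noloop.
pose dd (e : medge M) := d.
pose V := subdiv_vertex dd.
pose f (i j : 'I_#|V|) := subdiv_adj (enum_val i : V) (enum_val j : V).
have f_sym : symmetric f by move=> i j; apply: subdiv_adj_sym.
have f_irr : irreflexive f by move=> i; apply: subdiv_adj_irrefl.
exists #|V|, (SGraph f_sym f_irr); split.
  exists M, dd; split=> //; exists (@enum_val V predT); last by [].
  by exists enum_rank; [exact: fintype.enum_valK|exact: fintype.enum_rankK].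
move=> R S U U_sym.
have ps : path_system (SGraph f_sym f_irr) dd
    (fun e i => enum_rank (subdiv_path dd e i)).
  apply: (subdiv_path_system (phi := @enum_val V predT)) => //.
  - exact: fintype.enum_valK.
  - exact: fintype.enum_rankK.
rewrite (hom_mean_paths U_sym ps).
pose a : 'I_#|V| := enum_rank (inl false : V).
pose b : 'I_#|V| := enum_rank (inl true : V).
have ab : a != b by rewrite (inj_eq enum_rank_inj).
rewrite -(mean_pair (fun s t => path_kernel U d s t ^+ q) ab); apply: eq_mean => x.
rewrite (eq_bigr (fun=> path_kernel U d (x a) (x b))) ?prodr_const ?card_ord // => e _ /=.
by case: insubP => [j|_] //; rewrite ltnn.
Qed.

Definition cycle_pos d (b : bool) (i : nat) : 'I_(2 * d.+1) :=
  Ordinal (ltn_pmod (b * d.+1 + i) (isT : 0 < 2 * d.+1)%N).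

(** An even cycle consists of two paths between antipodal vertices; the second
    one runs from d + 1 back to 0. *)
Lemma cycle_paths d : (0 < d)%N ->
  path_system (cycle_graph (2 * d.+1)) (fun _ : bool => d) (cycle_pos d).
Proof.
move=> d0; set m := (2 * d.+1)%N; set pi := cycle_pos d.
have piE (b : bool) i : (i <= d.+1)%N ->
    val (pi b i) = if b && (i == d.+1) then 0%N else (b * d.+1 + i)%N.
  move=> id; rewrite /= /m mul2n -addnn; case: b => /=; rewrite ?mul1n ?mul0n ?add0n.
    case: eqP => [->|/eqP ne]; first by rewrite modnn.
    by rewrite modn_small // ltn_add2l ltn_neqAle ne.
  by rewrite modn_small // -addn1 leq_add.
split=> //.
- move=> b i b' i' /andP[i0 id] i'd /(congr1 val); rewrite !piE ?(leqW id) //.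
  rewrite [i == _]ltn_eqF ?ltnS // andbF.
  case: b; case: b' => /=; rewrite ?mul1n ?mul0n ?add0n.
  + by case: eqP => [_ /eqP|_ /addnI] //; rewrite addn_eq0.
  + by move=> E; move: i'd; rewrite -E -[X in (_ <= X)%N]addn0 leq_add2l leqNgt i0.
  + case: eqP => [_ E|_ E]; first by move: i0; rewrite E.
    by move: id; rewrite E leqNgt addSn ltnS leq_addr.
  + by [].
- by move=> b; rewrite -(inj_eq val_inj) !piE // eqxx; case: b.
- have next (b : bool) i : pi b i.+1 = pi b i + 1 %[mod m].
    by rewrite /= !modn_mod modnDml addn1 addnS.
  have mpos : (1 < m)%N by rewrite /m mul2n -addnn addSn ltnS addnS.
  have nodiag (x : nat) : (x == x.+1 %[mod m]) = false.
    apply/negbTE; rewrite -addn1 -[X in X == _ %[mod _]]addn0 eqn_modDl.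
    by rewrite mod0n modn_small.
  have pathof (x y : 'I_m) : val y = x.+1 %[mod m] -> exists b, exists2 i, (i <= d)%N &
      (x, y) = (pi b i, pi b i.+1).
    move=> yx; have pix : x = pi (d < x)%N (x - (d < x) * d.+1)%N.
      apply: val_inj; rewrite /= subnKC ?modn_small //.
      by case: ltnP => //; rewrite mul1n.
    exists (d < x)%N, (x - (d < x) * d.+1)%N.
      case: ltnP => dx; rewrite ?mul1n ?mul0n ?subn0 // leq_subLR -ltnS.
      by apply: leq_trans (ltn_ord x) _; rewrite /m mul2n -addnn addnS.
    rewrite -pix; congr (_, _); apply: val_inj; rewrite -[LHS](modn_small (ltn_ord y)) yx.
    rewrite -[RHS](modn_small (ltn_ord _)) next -pix addn1 //.
  move=> x y; split.
    case/andP=> _ /orP[/eqP/pathof[b [i id E]]|/eqP/pathof[b [i id E]]]; exists b, i => //.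
      by left.
    by right.
  have adjpi (b : bool) i : cycle_adj (pi b i) (pi b i.+1).
    have n1 : pi b i.+1 = (pi b i).+1 %[mod m] by rewrite next addn1.
    rewrite /cycle_adj n1 eqxx andbT; apply: contraFN (nodiag (pi b i)) => /eqP E.
    by rewrite {1}E n1.
  move=> [b [i id [[-> ->]|[-> ->]]]]; first exact: adjpi.
  rewrite /= cycle_adj_sym; exact: adjpi.
Qed.

Lemma cycle_mean (R : realFieldType) (S : finprob R) (U : S -> S -> R) d :
  (0 < d)%N -> (forall x y, U x y = U y x) ->
  hom_mean U (cycle_graph (2 * d.+1)) =
  mean (fun x => mean (fun y => path_kernel U d x y ^+ 2)).
Proof.
move=> d0 U_sym; rewrite (hom_mean_paths U_sym (cycle_paths d0)).
set pi := cycle_pos d.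
have p01 : pi false d.+1 = pi true 0%N by apply: val_inj; rewrite /= mul0n mul1n addn0.
have p10 : pi true d.+1 = pi false 0%N.
  by apply: val_inj; rewrite /= mul0n mul1n addn0 addnn -mul2n modnn mod0n.
rewrite -(mean_pair (fun s t => path_kernel U d s t ^+ 2) (ps_ends (cycle_paths d0) false)).
by apply: eq_mean => x; rewrite big_bool p10 p01 expr2 path_kernel_sym // -p01.
Qed.

(** * Stars and trees *)

Definition star_adj q : rel 'I_q.+1 := fun i j => (i == ord0) (+) (j == ord0).

Lemma star_adj_sym q : symmetric (@star_adj q).
Proof. by move=> i j; rewrite /star_adj addbC. Qed.

Lemma star_adj_irrefl q : irreflexive (@star_adj q).
Proof. by move=> i; rewrite /star_adj addbb. Qed.

Definition star_graph q : sgraph 'I_q.+1 :=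
  SGraph (@star_adj_sym q) (@star_adj_irrefl q).

Lemma star_is_tree q : is_tree (star_graph q).
Proof.
split; first by rewrite card_ord.
- have c0 x : connect (star_graph q) ord0 x.
    by case: (eqVneq x ord0) => [->|x0]; [exact: connect0|apply: connect1;
      rewrite /= /star_adj eqxx (negPf x0)].
  move=> x y; apply: connect_trans (c0 y); by rewrite (sym_connect_sym (@star_adj_sym q)).
- case=> [|a [|b [|c s]]] //; rewrite /ucycle /= /star_adj => /andP[].
  case: (eqVneq a ord0) => [a0|a0]; case: (eqVneq b ord0) => [b0|b0] //=;
    case: (eqVneq c ord0) => [c0|c0] //=; first by rewrite a0 c0 !inE eqxx orbT.
  case: s => [|e s] /=; first by rewrite (negPf a0) (negPf c0).
  case: (eqVneq e ord0) => [e0|_] /=; last by rewrite (negPf c0).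
  by rewrite b0 e0 !inE eqxx !orbT !andbF.
Qed.

Lemma star_mean (R : realFieldType) (S : finprob R) (U : S -> S -> R) q :
  hom_mean U (star_graph q) = mean (fun x => mean (U x) ^+ q).
Proof.
rewrite /hom_mean (mean_resample ord0).
transitivity (mean (S := pow_prob 'I_q.+1 S) (fun x => mean (fun z =>
   \prod_(j < q.+1) (if j == ord0 then 1 else U z (x j))))).
  apply: eq_mean => x; apply: eq_mean => z; rewrite big_ord_recl /=.
  rewrite [X in _ * X]big1 ?mulr1 => [|i _]; last first.
    by rewrite big1 // => j /andP[ij]; rewrite /star_adj /= -(inj_eq val_inj) /= gtn_eqF //
      (leq_trans _ ij).
  rewrite big_mkcond /=; apply: eq_bigr => j _; rewrite /star_adj eqxx /= !ffunE eqxx.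
  by rewrite lt0n -(inj_eq val_inj) /=; case: eqP.
rewrite mean_swap; apply: eq_mean => z.
rewrite (mean_pow_prod (fun (j : 'I_q.+1) s => if j == ord0 then 1 else U z s)).
rewrite big_ord_recl eqxx mean_cst mul1r (eq_bigr (fun=> mean (U z))).
  by rewrite prodr_const card_ord.
by move=> j _; apply: eq_mean => s.
Qed.

Section Build.
Variables (k : nat) (F : sgraph 'I_k).
Notation V := 'I_k.

(** Vertex sets obtained from a single vertex by attaching leaves: the new
    vertex v has exactly one neighbour in A. *)
Inductive built : seq V -> Prop :=
| Built1 r : built [:: r]
| BuiltS A u v : built A -> v \notin A -> u \in A -> F u v ->
    (forall w, w \in A -> F w v -> w = u) -> built (v :: A).

Let within (A : seq V) : rel V := fun x y => [&& F x y, x \in A & y \in A].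

(** Explore the tree: connectivity provides a next vertex v, and a second
    neighbour of v in the connected set A would close a cycle. *)
Lemma tree_built : is_tree F -> exists2 A, built A & forall x, x \in A.
Proof.
move=> [V0 conn acyc].
have grow A : built A -> (forall x y, x \in A -> y \in A -> connect (within A) x y) ->
    (exists r, r \in A) -> exists2 A, built A & forall x, x \in A.
  have [n] := ubnP #|[predC A]|; elim: n A => // n IH A cA bA cnA [r rA].
  have [/forallP allA|] := boolP [forall x, x \in A]; first by exists A.
  rewrite negb_forall => /existsP[y yA].
  have /existsP[u /existsP[v /and3P[uA vA Fuv]]] :
      [exists u, exists v, [&& u \in A, v \notin A & F u v]].
    apply: contraT; rewrite negb_exists => /forallP nouv; suff clA : fingraph.closed F (mem A).
      by move: yA; rewrite -[y \in A](closed_connect clA (conn r y)) rA.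
    apply: intro_closed => [|x z Fxz xA]; first exact: sym_connect_sym (adj_sym F).
    apply: contraT => zA; have := nouv x; rewrite negb_exists => /forallP/(_ z).
    by rewrite Fxz zA andbT; move: xA; rewrite /= => ->.
  have leaf w : w \in A -> F w v -> w = u.
    move=> wA Fwv; apply/eqP; apply: contraT => wu.
    have /connectP[p] := cnA _ _ uA wA; move/shortenP => [p' pp' up' _ wl].
    have p'A : {subset p' <= A}.
      by move=> z; elim: p' u pp' {uA Fuv wu up' wl} => // a p' IHp b /= /andP[/and3P[_ _
        aA] /IHp h]; rewrite inE => /predU1P[->|].
    have Fp' : path F u p'.
      by apply: sub_path pp' => a b /and3P[].
    have : ucycle F (v :: u :: p').
      apply/andP; split; last first.
        rewrite cons_uniq up' andbT inE negb_or; apply/andP; split.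
          by apply: contraNneq vA => ->.
        by apply: contra vA => /p'A.
      by rewrite /= adj_sym Fuv rcons_path Fp' -wl Fwv.
    move/acyc => /=; case: p' wl {pp' up' p'A Fp'} => //= wl.
    by move: wu; rewrite wl eqxx.
  apply: (IH (v :: A)).
  - rewrite -ltnS; apply: leq_trans _ cA; apply: proper_card; apply/properP; split.
      by apply/fintype.subsetP => x; rewrite !inE negb_or => /andP[].
    by exists v; rewrite !inE ?eqxx.
  - exact: BuiltS bA vA uA Fuv leaf.
  - have sub x z : connect (within A) x z -> connect (within (v :: A)) x z.
      apply: connect_sub => a b /and3P[Fab aA bB]; apply: connect1.
      by rewrite /within Fab !inE aA bB !orbT.
    have csym : connect_sym (within (v :: A)).
      by apply: sym_connect_sym => a b; rewrite /within adj_sym; congr (_ && _); rewrite andbC.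
    have cv x : x \in A -> connect (within (v :: A)) x v.
      move=> xA; apply: connect_trans (sub _ _ (cnA _ _ xA uA)) (connect1 _).
      by rewrite /within Fuv !inE eqxx uA orbT.
    move=> x z; rewrite !inE => /predU1P[->|xA] /predU1P[->|zA].
    + exact: connect0.
    + by rewrite csym; exact: cv.
    + exact: cv.
    + exact: sub (cnA _ _ xA zA).
  - by exists v; rewrite inE eqxx.
have /card_gt0P[r _] := V0.
apply: (grow [:: r]); first exact: Built1.
  by move=> x y; rewrite !inE => /eqP -> /eqP ->; exact: connect0.
by exists r; rewrite inE.
Qed.

(** Orienting the edges at v towards v isolates the factor of the new edge. *)
Lemma within_prodS (R : realFieldType) T (U : T -> T -> R) A u v (x : V -> T) :
  (forall s t, U s t = U t s) ->
  v \notin A -> u \in A -> F u v -> (forall w, w \in A -> F w v -> w = u) ->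
  orient_prod U (within (v :: A)) (fun i j : V => (i < j)%N) x =
  orient_prod U (within A) (fun i j : V => (i < j)%N) x * U (x u) (x v).
Proof.
move=> U_sym vA uA Fuv leaf.
have lto : orientation (within (v :: A)) (fun i j : V => (i < j)%N).
  by move=> i j /and3P[+ _ _]; exact: lt_orientation.
pose o (i j : V) := (j == v) || (i != v) && (i < j)%N.
have oo : orientation (within (v :: A)) o.
  move=> i j ij; rewrite /o (lto _ _ ij).
  have ne : i != j by apply: contraTneq ij => ->; rewrite /within adj_irrefl.
  case: (eqVneq i v) ne => [->|iv] ne; case: (eqVneq j v) ne => //= jv; rewrite ?eqxx //.
have wsym : symmetric (within (v :: A)).
  by move=> a b; rewrite /within adj_sym; congr (_ && _); rewrite andbC.
rewrite (orient_prod_eq U_sym x wsym lto oo) /orient_prod.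
rewrite (bigID (fun z => z.2 == v)) /= mulrC; congr (_ * _).
  apply: eq_bigl => -[i j] /=; rewrite /within /o !inE.
  case: (eqVneq j v) => [->|jv] /=; first by rewrite andbF (negPf vA) !andbF.
  case: (eqVneq i v) => [->|iv] /=; first by rewrite !andbF (negPf vA) andbF.
  by rewrite andbT.
rewrite (big_pred1 (u, v)) // => -[i j] /=; rewrite xpair_eqE.
case: (eqVneq j v) => [->|jv] /=; last by rewrite !andbF.
rewrite /within /o !inE !eqxx /= !andbT.
case: (eqVneq i u) => [->|iu]; first by rewrite Fuv uA orbT.
apply/negbTE/negP => /andP[Fiv /orP[/eqP iv|iA]].
  by move: Fiv; rewrite iv adj_irrefl.
by move: iu; rewrite (leaf _ iA Fiv) eqxx.
Qed.

Lemma built_uniq A : built A -> uniq A.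
Proof. by elim=> //= {}A u v _ -> ->. Qed.

Lemma within_sub A u v x : v \notin A -> within A u x -> (u != v) && (x != v).
Proof.
move=> vA /and3P[_ uA xA]; apply/andP; split.
  by apply: contraNneq vA => <-.
by apply: contraNneq vA => <-.
Qed.

(** Integrate out the vertices in the reverse of the order in which they were
    attached, keeping at each remaining vertex the rooted tree already hanging
    there: removing v hangs h v from its neighbour u. *)
Lemma built_rooted_tree A : built A -> forall h : V -> rooted_tree, exists t,
  forall (R : realFieldType) (S : finprob R) (U : S -> S -> R),
  (forall s t, U s t = U t s) ->
  mean (S := pow_prob V S) (fun x => \prod_(v <- A) tree_eval U (h v) (x v) *
     orient_prod U (within A) (fun i j : V => (i < j)%N) x) = mean (tree_eval U t).
Proof.
elim=> [r|{}A u v bA IH vA uA Fuv leaf] h.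
  exists (h r) => R S U U_sym; rewrite -(mean_single r (tree_eval U (h r))).
  apply: eq_mean => x; rewrite big_seq1 /orient_prod big1 ?mulr1 // => -[i j] /=.
  rewrite /within !inE => /andP[/and3P[Fij /eqP ir /eqP jr] _].
  by move: Fij; rewrite ir jr adj_irrefl.
have [t ht] := IH (fun w => if w == u then RTGlue (h u) (RTPlant (h v)) else h w).
exists t => R S U U_sym; rewrite -ht // (mean_resample v); apply: eq_mean => x.
transitivity (mean (fun z => (\prod_(w <- A) tree_eval U (h w) (x w) *
   orient_prod U (within A) (fun i j : V => (i < j)%N) x) *
   (U (x u) z * tree_eval U (h v) z))).
  apply: eq_mean => z.
  have updE w : w != v -> update x v z w = x w by rewrite ffunE => /negPf ->.
  have uv : u != v by apply: contraNneq vA => <-.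
  rewrite big_cons (within_prodS _ U_sym vA uA Fuv leaf) [update _ _ _ v]ffunE eqxx updE //.
  rewrite (eq_big_seq (fun w => tree_eval U (h w) (x w))); last first.
    by move=> w wA; rewrite updE //; apply: contraNneq vA => <-.
  rewrite /orient_prod (eq_bigr (fun z => U (x z.1) (x z.2))); last first.
    by move=> [i j] /= /andP[/(within_sub vA)/andP[iv jv] _]; rewrite !updE.
  by ring.
rewrite meanZ mulrAC; congr (_ * _).
rewrite !(big_rem u uA) /= eqxx /= mulrAC; congr (_ * _).
apply: eq_big_seq => w wA; case: eqP => // wu; move: wA.
by rewrite wu mem_rem_uniq ?built_uniq // !inE eqxx.
Qed.

Lemma tree_rooted_tree : is_tree F -> exists t,
  forall (R : realFieldType) (S : finprob R) (U : S -> S -> R),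
  (forall s t, U s t = U t s) -> hom_mean U F = mean (tree_eval U t).
Proof.
move=> /tree_built[A bA inA]; have [t ht] := built_rooted_tree bA (fun=> RTVertex).
exists t => R S U U_sym; rewrite -ht //; apply: eq_mean => x.
rewrite [X in _ = X * _]big1 // mul1r hom_prodE /orient_prod; apply: eq_bigl => z.
by rewrite /within !inA !andbT.
Qed.

End Build.

(** * The counting lemma on finite spaces *)

Section FiniteCounting.
Variables (R : realFieldType) (I : Type) (S : I -> finprob R).
Variables (W K : forall i, S i -> S i -> R) (eps : I -> R) (M : R).
Hypothesis W_ge0 : forall i x y, 0 <= @W i x y.
Hypothesis W_sym : forall i x y, @W i x y = @W i y x.
Hypothesis M_gt0 : 0 < M.
Hypothesis K_bnd : forall i x y, 0 <= @K i x y <= M.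
Hypothesis K_sym : forall i x y, @K i x y = @K i y x.
Hypothesis cutWK : forall i (A B : pred (S i)),
  `|mean (fun x => mean (fun y => (A x)%:R * (B y)%:R * (W x y - K x y)))| <= eps i.
Variable l : nat.
Hypothesis l_ge3 : (3 <= l)%N.
Hypothesis W_bnd : forall (k : nat) (F : sgraph 'I_k),
  is_tree F \/ in_Fge l F \/ graph_iso F (cycle_graph (2 * l - 2)) ->
  exists C, forall i, hom_mean (@W i) F <= C.

Let degree_moments : moments_bounded (fun i x => mean (@W i x)).
Proof.
split=> [i x|m]; first exact: mean_ge0.
have [C hC] := W_bnd (or_introl (star_is_tree (2 ^ m))).
by exists C => i; rewrite -star_mean.
Qed.

Notation S2 := (fun i => prod_prob (S i) (S i)).

Let path_kernel_moments d : (l.-1 <= d)%N -> moments_bounded (S :=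
  S2) (fun i z => path_kernel (@W i) d z.1 z.2).
Proof.
move=> ld; have d0 : (0 < d)%N by apply: leq_trans ld; case: l l_ge3 => [|[]].
split=> [i z|m]; first exact: path_kernel_ge0.
have [k [F [hF FE]]] := theta_graph (2 ^ m) ld d0.
have [C hC] := W_bnd (or_intror (or_introl hF)).
exists C => i; apply: le_trans (hC i); rewrite FE //.
by rewrite (mean_prod (fun x y => path_kernel (@W i) d x y ^+ (2 ^ m))).
Qed.

Let path_kernel_L2 d : (l - 2 <= d)%N ->
  exists C, forall i, mean (fun x => mean (fun y => path_kernel (@W i) d x y ^+ 2)) <= C.
Proof.
rewrite leq_eqVlt => /orP[/eqP <-|ld]; last first.
  have [|C hC] := proj2 (@path_kernel_moments d _) 1%N.
    by move: ld; case: l l_ge3 => [|[|[]]].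
  exists C => i; apply: le_trans (hC i).
  by rewrite (mean_prod (fun x y => path_kernel (@W i) d x y ^+ 2)).
have l2 : (0 < l - 2)%N by rewrite subn_gt0.
have [|C hC] := @W_bnd _ (cycle_graph (2 * l - 2)).
  by right; right; exists id => //; exists id.
exists C => i; apply: le_trans (hC i).
have E : (2 * l - 2 = 2 * (l - 2).+1)%N.
  by rewrite -subSn ?(ltnW l_ge3) // subSS mulnBr muln1.
by rewrite E cycle_mean.
Qed.

(** For trees this is tree_counting.  For subdivisions the density is the mean
    of a product of path kernels; these converge in L1 and have bounded moments,
    so their product converges. *)
Theorem finite_counting (k : nat) (F : sgraph 'I_k) : is_tree F \/ in_Fge l F ->
  vanish eps (fun i => hom_mean (@W i) F - hom_mean (@K i) F).
Proof.
case=> [/tree_rooted_tree[t ht]|/in_Fge_paths [|E [d [pi [ps ld]]]]].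
- apply: eq_vanish (tree_counting W_ge0 W_sym M_gt0 K_bnd cutWK degree_moments t) => i.
  by rewrite !ht.
- exact: ltnW.
pose PS i := pow_prob 'I_k (S i).
pose w e i (x : PS i) := path_kernel (@W i) (d e) (x (pi e 0%N)) (x (pi e (d e).+1)).
pose c e i (x : PS i) := path_kernel (@K i) (d e) (x (pi e 0%N)) (x (pi e (d e).+1)).
have K0 i x y : 0 <= @K i x y by case/andP: (@K_bnd i x y).
have ends e := ps_ends ps e.
have wMB e : moments_bounded (S := PS) (w e).
  split=> [i x|m]; first exact: path_kernel_ge0.
  have [C hC] := proj2 (path_kernel_moments (ld e)) m; exists C => i; apply: le_trans (hC i).
  rewrite (mean_prod (fun x y => path_kernel (@W i) (d e) x y ^+ (2 ^ m))).
  by rewrite (mean_pair (fun x y => path_kernel (@W i) (d e) x y ^+ (2 ^ m)) (ends e)).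
have cMB e : moments_bounded (S := PS) (c e).
  apply: moments_bounded_le (moments_bounded_cst PS (exprn_ge0 (d e).+1 (ltW M_gt0))) _ => i x.
  by rewrite path_kernel_ge0 //= path_kernel_le.
have wc e : vanish eps (fun i => mean (fun x => `|w e i x - c e i x|)).
  have le := ld e; have d0 := ps_pos ps e.
  have [|C hC] := @path_kernel_L2 (d e).-1.
    by rewrite -ltnS prednK // (leq_trans _ le) // -subSn ?subSS ?subn1 // ltnW.
  have := path_kernel_vanish W_ge0 W_sym M_gt0 K_bnd K_sym cutWK degree_moments
    (ex_intro _ C hC).
  apply: eq_vanish => i; rewrite prednK //.
  by rewrite (mean_pair (fun x y => `|path_kernel (@W i) (d e) x y - path_kernel (@K i)
    (d e) x y|) (ends e)).
apply: vanish_le (vanish_prod (index_enum E) wMB cMB wc) _ => i.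
by rewrite !(hom_mean_paths _ ps) // -meanB; exact: ler_norm_mean.
Qed.

End FiniteCounting.

Local Open Scope classical_set_scope.
Local Open Scope ring_scope.

(** * Functions constant on finitely many cells *)

Section FiniteValued.
Context d (T : measurableType d) (J : finType).

Lemma measurable_cells (D : set T) (cell : T -> J) (Y : set J) :
  (forall j, measurable (D `&` cell @^-1` [set j])) ->
  measurable (D `&` cell @^-1` Y).
Proof.
move=> mc.
have -> : D `&` cell @^-1` Y = \bigcup_(j in Y) (D `&` cell @^-1` [set j]).
  apply/seteqP; split=> [x [Dx Yx]|x [j Yj [Dx /= cxj]]]; first by exists (cell x).
  by split=> //=; rewrite cxj.
by apply: fin_bigcup_measurable => // ; exact: finite_finset.
Qed.

Lemma measurable_fun_cells d' (T' : measurableType d') (D : set T) (cell : T ->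
  J) (g : J -> T') :
  (forall j, measurable (D `&` cell @^-1` [set j])) ->
  measurable_fun D (fun x => g (cell x)).
Proof.
by move=> mc mD Y mY; exact: (@measurable_cells D cell (g @^-1` Y)).
Qed.

Lemma integral_cells (R : realType) (m : {measure set T -> \bar R}) (D : set T)
    (cell : T -> J) (v : J -> R) : measurable D -> (m D < +oo)%E ->
  (forall j, measurable (D `&` cell @^-1` [set j])) ->
  (\int[m]_(x in D) (v (cell x))%:E =
   (\sum_j v j * fine (m (D `&` cell @^-1` [set j])))%:E)%E.
Proof.
move=> mD mDoo mc.
have fj j : (m (D `&` cell @^-1` [set j]) \is a fin_num).
  rewrite ge0_fin_numE ?measure_ge0 //; apply: le_lt_trans mDoo.
  by apply: le_measure; rewrite ?inE //; exact: mc.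
have DE : D = \big[setU/set0]_(j <- index_enum J) (D `&` cell @^-1` [set j]).
  rewrite -bigcup_seq -setI_bigcupr -[LHS]setIT; congr (_ `&` _).
  by apply/seteqP; split=> // x _; exists (cell x) => //=; rewrite mem_index_enum.
rewrite [in LHS]DE integral_bigsetU_EFin /=; last 4 first.
- exact: mc.
- exact: index_enum_uniq.
- by move=> i j _ _ [x [[_ /= <-] [_ /= <-]]].
- by rewrite -DE; apply/measurable_EFinP; exact: measurable_fun_cells.
rewrite -sumEFin; apply: eq_bigr => j _.
rewrite EFinM fineK // -integral_cst; last exact: mc.
by apply: eq_integral => x; rewrite inE => -[_ /= ->].
Qed.

End FiniteValued.

(** * Lebesgue measure on the unit square *)

Section UnitSquare.
Variable R : realType.
Local Notation T := (measurableTypeR R).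
Local Notation mu := (@lebesgue_measure R).
Local Notation U := (@unitI R : set T).
Local Notation U2 := (U `*` U : set (T * T)).

Lemma measurable_unitI : measurable U.
Proof. exact: measurable_itv. Qed.

Lemma measurable_square : measurable U2.
Proof. by apply: measurableX; exact: measurable_unitI. Qed.

Lemma lebesgue_unitI : mu U = 1%E.
Proof.
by rewrite /unitI lebesgue_measure_itv /= lte_fin ltr01 oppr0 adde0.
Qed.

Lemma lebesgue_square : (mu \x mu)%E U2 = 1%E.
Proof.
rewrite product_measure1E; [|exact: measurable_unitI..].
exact: (etrans (congr2 mule lebesgue_unitI lebesgue_unitI) (mule1 _)).
Qed.

Let U_lty : (mu U < +oo)%E. Proof. by rewrite lebesgue_unitI ltry. Qed.

(** The uniqueness of product measures, applied to the restriction of Lebesgue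
    measure to the unit interval. *)
Lemma square_measure_unique (m : {measure set (T * T) -> \bar R}) :
  (forall A B : set T, measurable A -> measurable B -> A `<=` U -> B `<=` U ->
     m (A `*` B) = (mu A * mu B)%E) ->
  forall X, measurable X -> X `<=` U2 -> m X = (mu \x mu)%E X.
Proof.
move=> mE X mX XU.
pose lam : {finite_measure set T -> \bar R} := mfrestr measurable_unitI U_lty.
have key (m' : {measure set (T * T) -> \bar R}) :
    (forall A B : set T, measurable A -> measurable B -> A `<=` U -> B `<=` U ->
     m' (A `*` B) = (mu A * mu B)%E) -> m' X = (lam \x lam)%E X.
  move=> m'E; pose m1 : {measure set (T * T) -> \bar R} := mrestr m' measurable_square.
  rewrite -[in LHS](setIidl XU) -[LHS]/(m1 X); apply/esym.
  apply: product_measure_unique mX => A B mA mB.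
  rewrite [LHS]/(mrestr _ _ _) -setXI m'E //.
  - by apply: measurableI => //; exact: measurable_unitI.
  - by apply: measurableI => //; exact: measurable_unitI.
rewrite (key m mE); apply/esym; apply: (key (mu \x mu)%E) => A B mA mB _ _.
exact: product_measure1E.
Qed.

(** Used for pairs of coordinates of the cube, for the flip of the square and
    for a measure preserving map applied to both coordinates.  It is stated as
    an inequality because D may be smaller than the preimage of the square. *)
Lemma integral_square_le d (S : measurableType d) (m : {measure set S -> \bar R})
    (D : set S) (phi : S -> T * T) (h : T * T -> \bar R) :
  measurable D -> measurable_fun setT phi -> D `<=` phi @^-1` U2 ->
  (forall A B : set T, measurable A -> measurable B -> A `<=` U -> B `<=` U ->
     m (phi @^-1` (A `*` B) `&` D) = (mu A * mu B)%E) ->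
  measurable_fun U2 h -> (forall z, U2 z -> (0 <= h z)%E) ->
  (\int[m]_(x in D) h (phi x) <= \int[mu \x mu]_(z in U2) h z)%E.
Proof.
move=> mD mphi DU mE mh h0.
pose m1 : {measure set S -> \bar R} := mrestr m mD.
have mpre : measurable (phi @^-1` U2).
  by rewrite -[X in measurable X]setTI; apply: mphi => //; exact: measurable_square.
rewrite (@eq_measure_integral _ _ _ D m1); last first.
  by move=> A mA AD; rewrite /m1 /= /mrestr setIidl.
have mhphi : measurable_fun (phi @^-1` U2) (h \o phi).
  apply: (measurable_comp measurable_square) => //.
    by move=> _ [x hx <-].
  exact: measurable_funTS.
apply: (@le_trans _ _ (\int[m1]_(x in phi @^-1` U2) (h \o phi) x)%E).
  by apply: ge0_subset_integral => // x hx; exact: h0.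
rewrite -ge0_integral_pushforward //; last 2 first.
- exact: measurable_square.
- by move=> z; rewrite inE; exact: h0.
rewrite le_eqVlt; apply/orP; left; apply/eqP; apply: eq_measure_integral => X mX XU.
pose m2 : {measure set (T * T) -> \bar R} :=
  measure_function_pushforward__canonical__measure_function_Measure m1 mphi.
apply: (square_measure_unique (m := m2)) => // A B mA mB AU BU.
Qed.

End UnitSquare.

(** * Approximation of kernels by step kernels *)

Section StepApproximation.
Variable R : realType.
Local Notation T := (measurableTypeR R).
Local Notation mu := (@lebesgue_measure R).
Local Notation U := (@unitI R : set T).
Local Notation U2 := (U `*` U : set (T * T)).

Definition L1_square (f : T * T -> R) : \bar R :=
  (\int[mu \x mu]_(z in U2) (`|f z|)%:E)%E.

Let mU2 : measurable U2. Proof. exact: measurable_square. Qed.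

Let mabs (f : T * T -> R) : measurable_fun U2 f ->
  measurable_fun U2 (fun z => (`|f z|)%:E).
Proof. by move=> mf; apply/measurable_EFinP; exact: measurableT_comp. Qed.

Implicit Types f g h : T * T -> R.

Lemma L1_square_leD f g h :
  measurable_fun U2 f -> measurable_fun U2 g -> measurable_fun U2 h ->
  (forall z, U2 z -> `|f z| <= `|g z| + `|h z|) ->
  (L1_square f <= L1_square g + L1_square h)%E.
Proof.
move=> mf mg mh fgh; rewrite /L1_square -ge0_integralD //; try exact: mabs.
apply: ge0_le_integral => //; first exact: mabs.
by apply: emeasurable_funD; exact: mabs.
Qed.

Lemma L1_square_leZ a f g : 0 <= a ->
  measurable_fun U2 f -> measurable_fun U2 g ->
  (forall z, U2 z -> `|f z| <= a * `|g z|) ->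
  (L1_square f <= a%:E * L1_square g)%E.
Proof.
move=> a0 mf mg fg; rewrite /L1_square -ge0_integralZl_EFin //; last exact: mabs.
apply: ge0_le_integral => //; first exact: mabs.
by apply: measurable_funeM; exact: mabs.
Qed.

Lemma L1_square_le_cst a f : measurable_fun U2 f ->
  (forall z, U2 z -> `|f z| <= a) -> (L1_square f <= a%:E)%E.
Proof.
move=> mf fa; rewrite -[leRHS]mule1 -(lebesgue_square R) -(integral_cst _ mU2).
apply: ge0_le_integral => //; exact: mabs.
Qed.

Section Step.
Variables (J : finType) (c : T -> J).
Hypothesis mc : forall j, measurable (c @^-1` [set j]).

Lemma measurable_fst_cell j : measurable ((fun z : T * T => c z.1) @^-1` [set j]).
Proof.
rewrite -[X in measurable X]setTI.
rewrite (_ : _ @^-1` _ = fst @^-1` (c @^-1` [set j])) //.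
exact: (@measurable_fst _ _ T T).
Qed.

Lemma measurable_snd_cell j : measurable ((fun z : T * T => c z.2) @^-1` [set j]).
Proof.
rewrite -[X in measurable X]setTI.
rewrite (_ : _ @^-1` _ = snd @^-1` (c @^-1` [set j])) //.
exact: (@measurable_snd _ _ T T).
Qed.

Lemma measurable_step (v : J -> J -> R) :
  measurable_fun setT (fun z : T * T => v (c z.1) (c z.2)).
Proof.
apply: (measurable_fun_cells (cell := fun z : T * T => (c z.1, c z.2))
  (fun jj => v jj.1 jj.2)) => -[j j'].
rewrite setTI (_ : _ @^-1` _ = (fun z : T * T => c z.1) @^-1` [set j] `&`
   (fun z : T * T => c z.2) @^-1` [set j']).
  by apply: measurableI; [exact: measurable_fst_cell|exact: measurable_snd_cell].
by apply/seteqP; split=> z /=; [case=> -> ->|case=> -> ->].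
Qed.

End Step.

(** Both variables use the same partition c, whose cells can then serve as
    points of a finite weighted space. *)
Definition step_approximable (f : T * T -> R) : Prop :=
  measurable_fun U2 f /\ forall e, 0 < e ->
  exists (J : finType) (c : T -> J) (v : J -> J -> R),
    (forall j, measurable (c @^-1` [set j])) /\
    (L1_square (fun z => f z - v (c z.1) (c z.2))%R <= e%:E)%E.

Let mstep (J : finType) (c : T -> J) (v : J -> J ->
  R) : (forall j : J, measurable (c @^-1` [set j])) ->
  measurable_fun U2 (fun z : T * T => v (c z.1) (c z.2) : R).
Proof. by move=> mc; exact: (measurable_funTS (measurable_step mc v)). Qed.

Lemma step_approximableD f g : step_approximable f -> step_approximable g ->
  step_approximable (fun z => f z + g z).
Proof.
move=> [mf hf] [mg hg]; split; first exact: measurable_funD.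
move=> e e0; have e2 : 0 < e / 2 by lra.
have [J [c [v [mc cv]]]] := hf _ e2; have [J' [c' [v' [mc' cv']]]] := hg _ e2.
exists (J * J')%type, (fun x => (c x, c' x)), (fun p q => v p.1 q.1 + v' p.2 q.2).
split=> [[j j']|].
  rewrite (_ : _ @^-1` _ = (c @^-1` [set j]) `&` (c' @^-1` [set j'])).
    exact: measurableI.
  by apply/seteqP; split=> z /=; [case=> -> ->|case=> -> ->].
rewrite (splitr e) EFinD; apply: le_trans (leeD cv cv').
have m1 : measurable_fun U2 (fun z => f z - v (c z.1) (c z.2)).
  by apply: measurable_funB => //; exact: (mstep v mc).
have m2 : measurable_fun U2 (fun z => g z - v' (c' z.1) (c' z.2)).
  by apply: measurable_funB => //; exact: (mstep v' mc').
apply: L1_square_leD => //.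
  apply: measurable_funB; first exact: measurable_funD.
  by apply: measurable_funD; [exact: (mstep v mc)|exact: (mstep v' mc')].
move=> z _; apply: le_trans (ler_normD _ _).
by rewrite le_eqVlt; apply/orP; left; apply/eqP; congr `|_|; ring.
Qed.

Lemma step_approximableZ a f : step_approximable f ->
  step_approximable (fun z => a * f z).
Proof.
move=> [mf hf]; split; first by apply: measurable_funM.
move=> e e0; have a0 : 0 < `|a| + 1 by rewrite ltr_wpDl.
have [J [c [v [mc cv]]]] := hf (e / (`|a| + 1)) (divr_gt0 e0 a0).
exists J, c, (fun p q => a * v p q); split=> //.
have m1 : measurable_fun U2 (fun z => f z - v (c z.1) (c z.2)).
  by apply: measurable_funB => //; exact: (mstep v mc).
apply: le_trans (_ : (`|a| + 1)%:E * L1_square (fun z => f z - v (c z.1) (c z.2))%R <= _)%E.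
  apply: (L1_square_leZ (ltW a0)) => //.
    apply: measurable_funB; first exact: measurable_funM.
    by apply: measurable_funM => //; exact: (mstep v mc).
  by move=> z _; rewrite -mulrBr normrM ler_wpM2r // lerDl.
rewrite (_ : e%:E = ((`|a| + 1)%:E * (e / (`|a| + 1))%:E)%E).
  by apply: lee_wpmul2l cv; rewrite lee_fin ltW.
by rewrite -EFinM; congr EFin; field; rewrite gt_eqF.
Qed.

Lemma step_approximable_lim f : measurable_fun U2 f ->
  (forall e, 0 < e -> exists2 g, step_approximable g &
     (L1_square (fun z => f z - g z)%R <= e%:E)%E) ->
  step_approximable f.
Proof.
move=> mf hf; split=> // e e0; have e2 : 0 < e / 2 by lra.
have [g [mg hg] fg] := hf _ e2; have [J [c [v [mc cv]]]] := hg _ e2.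
exists J, c, v; split=> //; rewrite (splitr e) EFinD.
apply: le_trans (leeD fg cv).
have ms := mstep v mc; apply: L1_square_leD; try exact: measurable_funB.
by move=> z _; apply: ler_distD.
Qed.

Lemma step_approximable_rect (A B : set T) : measurable A -> measurable B ->
  step_approximable (\1_(A `*` B)).
Proof.
move=> mA mB; split; first by apply: measurable_funTS; apply: measurable_indic;
  exact: measurableX.
move=> e e0; exists (bool * bool)%type, (fun x => (x \in A, x \in B)).
exists (fun p q => (p.1 && q.2)%:R); split=> [[a b]|].
  have mb (C : set T) bb : measurable C -> measurable [set x | (x \in C) = bb].
    move=> mC; case: bb.
      by rewrite (_ : [set _ | _] = C) //; apply/seteqP; split=> x /=;
        [exact: set_mem|exact: mem_set].
    rewrite (_ : [set _ | _] = ~` C); first exact: measurableC.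
    apply/seteqP; split=> x /=; first by move=> h /mem_set; rewrite h.
    exact: memNset.
  rewrite (_ : _ @^-1` _ = [set x | (x \in A) = a] `&` [set x | (x \in B) = b]).
    by apply: measurableI; exact: mb.
  by apply/seteqP; split=> z /=; [case=> -> ->|case=> -> ->].
rewrite /L1_square (eq_integral (fun=> 0%E)) ?integral0 ?lee_fin ?ltW // => z _.
by rewrite indicE in_setX subrr normr0.
Qed.

(** The pi-lambda theorem: the class of such sets contains the rectangles, and
    it is stable under proper differences by linearity and under increasing
    unions since the square has finite measure. *)
Lemma step_approximable_indic (X : set (T * T)) : measurable X ->
  step_approximable (\1_X).
Proof.
pose H := [set X : set (T * T) | measurable X /\ step_approximable (\1_X)].
suff sub : measurable `<=` H by move=> mX; case: (sub _ mX).
rewrite measurable_prod_measurableType.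
set C := [set A1 `*` A2 | A1 in measurable & A2 in measurable].
have CI : setI_closed C.
  move=> X1 Y1 [A1 mA1 [A2 mA2 <-]] [B1 mB1 [B2 mB2 <-]].
  exists (A1 `&` B1); first exact: measurableI.
  by exists (A2 `&` B2); [exact: measurableI|rewrite setXI].
have CH : C `<=` H.
  move=> Z [A1 mA1 [A2 mA2 <-]]; split; first exact: measurableX.
  exact: step_approximable_rect.
suff lH : lambda_system setT H by exact: lambda_system_subset.
split => //.
- by apply: CH; exists setT => //; exists setT => //; rewrite setXTT.
- move=> Y Z ZY [mY aY] [mZ aZ]; split; first exact: measurableD.
  have -> : (\1_(Y `\` Z) : T * T -> R) = (fun z => \1_Y z + (-1) * \1_Z z).
    apply/funext => z; rewrite !indicE in_setD.
    case: (boolP (z \in Z)) => zZ; last by rewrite andbT mulr0 addr0.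
    by rewrite (mem_set (ZY _ (set_mem zZ))) /= mulN1r subrr.
  exact: step_approximableD (step_approximableZ _ aZ).
- move=> F ndF HF; have mF n : measurable (F n) by case: (HF n).
  have mFF : measurable (\bigcup_n F n) by exact: bigcupT_measurable.
  split=> //; apply: step_approximable_lim.
    by apply: measurable_funTS; exact: measurable_indic.
  move=> e e0.
  pose m1 : {measure set (T * T) -> \bar R} := mrestr (mu \x mu)%E mU2.
  have m1oo Y : measurable Y -> (m1 Y <= 1)%E.
    move=> mY; apply: (@le_trans _ _ ((mu \x mu)%E U2)); last by rewrite lebesgue_square.
    rewrite [leLHS]/(mrestr _ _ _); apply: le_measure; rewrite ?inE //.
    exact: measurableI.
  have cv : m1 \o F @ \oo --> m1 (\bigcup_n F n).
    exact: nondecreasing_cvg_mu.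
  have fin1 Y : measurable Y -> m1 Y \is a fin_num.
    by move=> mY; rewrite ge0_fin_numE // (le_lt_trans (m1oo _ mY)) // ltry.
  have [n hn] : exists n, (m1 (\bigcup_n F n) <= m1 (F n) + e%:E)%E.
    have cv' : fine (m1 (F n)) @[n --> \oo] --> fine (m1 (\bigcup_n F n)).
      by apply: fine_cvg; rewrite fineK ?fin1.
    move/cvgrPdist_le : cv' => /(_ _ e0)[n _ hn].
    exists n; rewrite -(fineK (fin1 _ mFF)) -(fineK (fin1 _ (mF n))) -EFinD lee_fin.
    by have := hn n (leqnn n); rewrite /= => /(le_trans (ler_norm _)); lra.
  exists (\1_(F n)); first by case: (HF n).
  have FU : F n `<=` \bigcup_n F n by apply: bigcup_sup.
  rewrite /L1_square (eq_integral (fun z => (\1_((\bigcup_n F n) `\` F n) z)%:E)).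
    rewrite integral_indic //; last exact: measurableD.
    rewrite -[leLHS]/(m1 _) measureD // ?(le_lt_trans (m1oo _ mFF)) ?ltry //.
    by rewrite (setIidr FU) leeBlDr ?fin1 // addeC.
  move=> z _; rewrite !indicE in_setD.
  case: (boolP (z \in F n)) => zF; last by rewrite andbT subr0 ger0_norm.
  by rewrite (mem_set (FU _ (set_mem zF))) /= subrr normr0.
Qed.

(** The layer cake formula with step h. *)
Lemma level_count (h t : R) N : 0 < h -> 0 <= t <= N%:R * h ->
  t <= h * \sum_(q < N) (q%:R * h < t)%R%:R <= t + h.
Proof.
move=> h0; elim: N => [|N IH] /andP[t0 tN].
  by rewrite big_ord0 mulr0; apply/andP; split; lra.
rewrite big_ord_recr /=; case: (leP t (N%:R * h)) => tNh /=.
  by rewrite addr0 IH // t0.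
rewrite (eq_bigr (fun=> 1)) => [|q _]; last first.
  suff -> : q%:R * h < t by [].
  apply: le_lt_trans tNh; apply: ler_wpM2r; [exact: ltW|by rewrite ler_nat ltnW].
rewrite sumr_const card_ord mulr1n.
move: tN; rewrite -natr1 => tN; apply/andP; split; lra.
Qed.

Lemma step_approximable_bounded (f : T * T -> R) M : measurable_fun U2 f ->
  (forall z, U2 z -> 0 <= f z <= M) -> step_approximable f.
Proof.
move=> mf fM; apply: step_approximable_lim => // e e0.
have M0 : 0 <= M.
  have /fM/andP[] : U2 (0, 0) by split=> /=; rewrite /unitI /= in_itv /= lexx ler01.
  exact: le_trans.
pose N := (Num.trunc (M / e)).+1.
have MN : M <= N%:R * e.
  by rewrite -ler_pdivrMr // ltW // truncnS_gt.
pose X (q : 'I_N) := U2 `&` f @^-1` [set y | q%:R * e < y].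
have mX q : measurable (X q).
  by apply: mf => //; rewrite (_ : [set y | _] = `]q%:R * e, +oo[%classic) // set_itvoy.
exists (fun z => e * \sum_(q < N) \1_(X q) z).
  apply: step_approximableZ; elim: (index_enum _) => [|q r IH].
    have -> : (fun z => \sum_(q <- [::]) \1_(X q) z : R) = \1_(set0 : set (T * T)).
      by apply/funext => z; rewrite big_nil indicE in_set0.
    exact: step_approximable_indic.
  have -> : (fun z => \sum_(q <- q :: r) \1_(X q) z : R) =
            (fun z => \1_(X q) z + \sum_(q <- r) \1_(X q) z).
    by apply/funext => z; rewrite big_cons.
  exact: step_approximableD (step_approximable_indic (mX q)) IH.
apply: L1_square_le_cst.
  apply: measurable_funB => //; apply: measurable_funM => //.
  by apply: measurable_sum => q; apply: measurable_funTS; exact: measurable_indic.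
move=> z Uz; have /andP[f0 fz] := fM z Uz.
have := @level_count e (f z) N e0; rewrite f0 (le_trans fz MN) => /(_ isT).
rewrite (eq_bigr (fun q : 'I_N => \1_(X q) z)) => [|q _]; last first.
  rewrite indicE; congr (nat_of_bool _)%:R; apply/idP/idP => [h|/set_mem[]//].
  by apply: mem_set; split.
by move=> /andP[h1 h2]; rewrite ler_norml; apply/andP; split; lra.
Qed.

Lemma L1_square_swap f : measurable_fun U2 f ->
  (L1_square (fun z => f (z.2, z.1)) <= L1_square f)%E.
Proof.
move=> mf; apply: (@integral_square_le _ _ _ _ U2 (fun z : T * T => (z.2, z.1))
  (fun z => (`|f z|)%:E)) => //.
- by apply: measurable_fun_pair; [exact: measurable_snd|exact: measurable_fst].
- by move=> [x y] [].
- move=> A B mA mB AU BU.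
  rewrite (_ : _ `&` _ = B `*` A); first by rewrite muleC; exact: product_measure1E.
  by apply/seteqP; split=> -[x y] /= [] => [[? ?] _|? ?]; split=> //; split;
    [exact: BU|exact: AU].
- exact: mabs.
Qed.

Lemma clamp_dist (k t M : R) : 0 <= k <= M ->
  `|k - Num.max 0 (Num.min t M)| <= `|k - t|.
Proof.
move=> /andP[k0 kM]; case: (leP t M) => tM; last first.
  rewrite max_r ?(le_trans k0) // ler0_norm ?subr_le0 //.
  by rewrite -normrN; apply: le_trans (ler_norm _); lra.
case: (leP 0 t) => t0; first by rewrite lexx.
by rewrite subr0 ger0_norm //; apply: le_trans (ler_norm _); lra.
Qed.

(** Truncating the values to [0, M] and symmetrizing do not increase the L1
    distance to a symmetric kernel with values in [0, M]. *)
Lemma kernel_step_approx (kappa : R -> R -> R) M e :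
  is_kernel kappa -> (forall x y, unitI x -> unitI y -> kappa x y <= M) ->
  0 < e ->
  exists (J : finType) (c : T -> J) (v : J -> J -> R),
  [/\ forall j, measurable (c @^-1` [set j]),
      forall a b, 0 <= v a b <= M,
      forall a b, v a b = v b a
    & (L1_square (fun z => kappa z.1 z.2 - v (c z.1) (c z.2))%R <= e%:E)%E].
Proof.
move=> [mk ksym k0] kM e0.
have M0 : 0 <= M.
  have U0 : unitI (0 : R) by rewrite /unitI /= in_itv /= lexx ler01.
  exact: le_trans (k0 0 0 U0 U0) (kM 0 0 U0 U0).
pose k z := kappa z.1 z.2.
have [|_ /(_ e e0)[J [c [v [mc cv]]]]] := @step_approximable_bounded k M mk.
  by move=> [x y] [/= xU yU]; rewrite k0 // kM.
pose cl t := Num.max 0 (Num.min t M).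
have cl0 t : 0 <= cl t <= M by rewrite /cl le_max lexx ge_max M0 ge_min lexx orbT.
have clk z t : U2 z -> `|k z - cl t| <= `|k z - t|.
  by case: z => x y [/= xU yU]; apply: clamp_dist; rewrite k0 // kM.
exists J, c, (fun a b => (cl (v a b) + cl (v b a)) / 2); split=> //.
- by move=> a b; have := cl0 (v a b); have := cl0 (v b a); lra.
- by move=> a b; rewrite addrC.
pose g z := k z - v (c z.1) (c z.2).
have mg : measurable_fun U2 g by apply: measurable_funB => //; exact: (mstep v mc).
pose gs (z : T * T) := g (z.2, z.1).
have mgs : measurable_fun U2 gs.
  apply: (measurable_comp mU2) => //; first by move=> _ [[x y] [? ?] <-].
  apply: measurable_funTS; apply: measurable_fun_pair;
    [exact: measurable_snd|exact: measurable_fst].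
have h2 : 0 <= 1 / 2 :> R by lra.
have mh f : measurable_fun U2 f -> measurable_fun U2 (fun z => 1 / 2 * f z).
  by move=> mf; exact: measurable_funM.
have half f : measurable_fun U2 f -> (L1_square f <= e%:E)%E ->
    (L1_square (fun z => 1 / 2 * f z)%R <= (e / 2)%:E)%E.
  move=> mf fe; apply: le_trans (L1_square_leZ h2 (mh _ mf) mf _) _.
    by move=> z _; rewrite normrM (ger0_norm h2).
  apply: le_trans (lee_wpmul2l _ fe) _; first by rewrite lee_fin.
  by rewrite -EFinM lee_fin; lra.
rewrite (splitr e) EFinD.
apply: le_trans (leeD (half _ mg cv) (half _ mgs (le_trans (L1_square_swap mg) cv))).
apply: L1_square_leD; try exact: mh.
  apply: measurable_funB => //.
  exact: (mstep (fun a b => (cl (v a b) + cl (v b a)) / 2) mc).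
have E (u : R) : `|1 / 2 * u| = 1 / 2 * `|u| by rewrite normrM (ger0_norm h2).
move=> [x y] [/= xU yU]; rewrite /gs /g !E.
have h1 := clk (x, y) (v (c x) (c y)) (conj xU yU).
have h3 := clk (y, x) (v (c y) (c x)) (conj yU xU).
rewrite -mulrDr mul1r [leRHS]mulrC; move: h1 h3; rewrite /k /= (ksym y x) // => h1 h3.
rewrite ler_pdivlMr //.
apply: le_trans (lerD h1 h3); apply: le_trans (ler_normD _ _).
rewrite -[X in _ * X <= _](ger0_norm (ler0n R 2)) -[leLHS]normrM le_eqVlt; apply/orP; left.
by apply/eqP; congr `|_|; field.
Qed.

End StepApproximation.

(** * Homomorphism integrals of step kernels *)

Section CellProbability.
Context d (T : measurableType d) (R : realType) (m : {measure set T -> \bar R}).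
Variables (J : finType) (D : set T) (cell : T -> J).
Hypothesis mD : measurable D.
Hypothesis D1 : m D = 1%E.
Hypothesis mc : forall j, measurable (D `&` cell @^-1` [set j]).

Let cell_wt_ge0 j : 0 <= fine (m (D `&` cell @^-1` [set j])).
Proof. by rewrite fine_ge0. Qed.

Lemma cell_wt_sum : \sum_j fine (m (D `&` cell @^-1` [set j])) = 1.
Proof.
apply: EFin_inj; rewrite -D1 -[RHS]mul1e -integral_cst //.
rewrite (integral_cells (cell := cell) (fun=> 1)) ?D1 ?ltry //.
by congr EFin; apply: eq_bigr => j _; rewrite mul1r.
Qed.

Definition cell_prob : finprob R := @FinProb R J _ cell_wt_ge0 cell_wt_sum.

Lemma cell_fin_num (A : set T) : measurable A -> A `<=` D -> m A \is a fin_num.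
Proof.
move=> mA AD; rewrite ge0_fin_numE ?measure_ge0 //; apply: (@le_lt_trans _ _ (m D)).
  by apply: le_measure; rewrite ?inE.
by rewrite D1 ltry.
Qed.

End CellProbability.

Lemma prod_dist_le (R : realDomainType) (E : Type) (r : seq E) (P : pred E) (a b : E -> R) M :
  1 <= M -> (forall e, 0 <= a e <= M) -> (forall e, 0 <= b e <= M) ->
  `|\prod_(e <- r | P e) a e - \prod_(e <- r | P e) b e| <=
  M ^+ size r * \sum_(e <- r | P e) `|a e - b e|.
Proof.
move=> M1 aM bM; have M0 : 0 <= M by apply: le_trans M1.
have bnd (f : E -> R) s : (forall e, 0 <= f e <= M) ->
  0 <= \prod_(e <- s | P e) f e <= M ^+ size s.
  move=> fM; elim: s => [|e s /andP[IH0 IH]] /=; first by rewrite big_nil expr0 ler01 lexx.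
  have /andP[f0 fe] := fM e.
  rewrite big_cons exprS; case: (P e).
    by rewrite mulr_ge0 //= ler_pM.
  by rewrite IH0 (le_trans IH) // ler_peMl ?exprn_ge0.
elim: r => [|e r IH]; first by rewrite !big_nil subrr normr0 mulr0.
rewrite !big_cons /=.
have Mr : M ^+ size r <= M ^+ (size r).+1 by rewrite exprS ler_peMl ?exprn_ge0.
have S0 : 0 <= \sum_(e <- r | P e) `|a e - b e| by rewrite sumr_ge0.
case: (P e); last by apply: le_trans IH _; rewrite ler_wpM2r.
set u := \prod_(_ <- _ | _) _; set w := \prod_(_ <- _ | _) _.
have -> : a e * u - b e * w = (a e - b e) * u + b e * (u - w) by ring.
apply: le_trans (ler_normD _ _) _; rewrite !normrM mulrDr.
have /andP[u0 uM] := bnd a r aM; have /andP[b0 be] := bM e.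
apply: lerD.
  by rewrite (ger0_norm u0) mulrC ler_wpM2r // (le_trans uM).
by rewrite (ger0_norm b0) exprS -mulrA ler_pM.
Qed.

Lemma size_index_enum (E : finType) : size (index_enum E) = #|E|.
Proof. by rewrite -sum1_size -sum1_card; apply: eq_bigl. Qed.

Section HomIntegral.
Variable R : realType.
Local Notation T := (measurableTypeR R).
Local Notation mu := (@lebesgue_measure R).
Local Notation U := (@unitI R : set T).
Local Notation U2 := (U `*` U : set (T * T)).
Variable k : nat.
Local Notation P := (@lebesgue_tuple R k).

Definition cube : set (k.-tuple T) := [set x | forall i, unitI (tnth x i)].

Let measurable_box (A : 'I_k -> set T) : (forall i, measurable (A i)) ->
  measurable [set x : k.-tuple T | forall i, A i (tnth x i)].
Proof.
move=> mA.
rewrite (_ : [set _ | _] = \bigcap_(i in [set: 'I_k]) ((@tnth k T)^~ i @^-1` A i)).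
  apply: fin_bigcap_measurable => // i _.
  by rewrite -[X in measurable X]setTI; apply: measurable_tnth.
by apply/seteqP; split => x /= h i; [move=> _; exact: h|exact: h].
Qed.

Lemma measurable_cube : measurable cube.
Proof. by apply: (@measurable_box (fun=> U)) => i; exact: measurable_unitI. Qed.

Lemma lebesgue_cube : P cube = 1%E.
Proof.
rewrite /cube (lebesgue_tuple_box (A := fun=> U)); last by move=> _; exact: measurable_unitI.
by rewrite big1 // => i _; exact: lebesgue_unitI.
Qed.

Let cube_lty : (P cube < +oo)%E. Proof. by rewrite lebesgue_cube ltry. Qed.

Let measurable_coord2 (i j : 'I_k) :
  measurable_fun setT (fun x : k.-tuple T => (tnth x i, tnth x j)).
Proof. by apply: measurable_fun_pair; exact: measurable_tnth. Qed.

Let measurable_cube_coord2 (g : T * T -> R) (i j : 'I_k) : measurable_fun U2 g ->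
  measurable_fun cube (fun x : k.-tuple T => g (tnth x i, tnth x j)).
Proof.
move=> mg; pose phi (x : k.-tuple T) := (tnth x i, tnth x j).
have im : [set phi x | x in cube] `<=` U2 by move=> _ [x cx <-]; split; exact: cx.
have mphi : measurable_fun cube phi by exact: (measurable_funTS (measurable_coord2 i j)).
exact: (measurable_comp (@measurable_square R) im mg mphi).
Qed.

(** Two coordinates of the cube are independent and uniform, so each edge
    contributes the L1 distance on the square. *)
Lemma hom_integral_marginal (i j : 'I_k) (h : T * T -> R) : i != j ->
  measurable_fun U2 h ->
  (\int[P]_(x in cube) (`|h (tnth x i, tnth x j)|)%:E <= L1_square h)%E.
Proof.
move=> ij mh; apply: (@integral_square_le _ _ _ _ cube _ (fun z => (`|h z|)%:E)) => //.
- exact: measurable_cube.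
- by move=> x cx; split; exact: cx.
- move=> A B mA mB AU BU.
  pose C l := if l == i then A else if l == j then B else U.
  have mC l : measurable (C l).
    by rewrite /C; case: ifP => // _; case: ifP => // _; exact: measurable_unitI.
  rewrite (_ : _ `&` _ = [set x | forall l, C l (tnth x l)]).
    rewrite [LHS](lebesgue_tuple_box mC) (bigD1 i) //= (bigD1 j) 1?eq_sym //= big1.
      by rewrite mule1 /C eqxx eq_sym (negPf ij) eqxx.
    by move=> l /andP[/negPf li /negPf lj]; rewrite /C li lj; exact: lebesgue_unitI.
  apply/seteqP; split=> x /=.
    move=> [[Ax Bx] cx] l; rewrite /C; case: eqP => [->//|_]; case: eqP => [->//|_].
    exact: cx.
  move=> h'; have hi := h' i; have hj := h' j; move: hi hj.
  rewrite /C !eqxx eq_sym (negPf ij) => hi hj; do !split=> //.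
  move=> l; have := h' l; rewrite /C; case: eqP => [_|_]; first exact: AU.
  by case: eqP => // _; exact: BU.
- by apply/measurable_EFinP; exact: measurableT_comp.
Qed.

Lemma measurable_hom_prod (F : sgraph 'I_k) (kappa : R -> R -> R) :
  measurable_fun U2 (fun z => kappa z.1 z.2) ->
  measurable_fun cube (fun x : k.-tuple T =>
    \prod_(i < k) \prod_(j < k | (i < j)%N && F i j) kappa (tnth x i) (tnth x j)).
Proof.
move=> mk; apply: measurable_prod => i _.
under eq_fun do rewrite -big_filter.
apply: measurable_prod => j _.
exact: (measurable_cube_coord2 i j mk).
Qed.

Lemma integrable_hom_prod (F : sgraph 'I_k) (kappa : R -> R -> R) M :
  measurable_fun U2 (fun z => kappa z.1 z.2) ->
  (forall x y, unitI x -> unitI y -> 0 <= kappa x y <= M) ->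
  P.-integrable cube (EFin \o (fun x : k.-tuple T =>
    \prod_(i < k) \prod_(j < k | (i < j)%N && F i j) kappa (tnth x i) (tnth x j))).
Proof.
move=> mk kM; apply: measurable_bounded_integrable.
- exact: measurable_cube.
- exact: cube_lty.
- exact: measurable_hom_prod.
exists (\prod_(i < k) \prod_(j < k | (i < j)%N && F i j) M).
split; first exact: num_real.
move=> N MN x cx; apply: le_trans (ltW MN); rewrite /= normr_prod; apply: ler_prod => i _;
  rewrite normr_ge0 normr_prod.
apply: ler_prod => j _; rewrite normr_ge0; have /andP[? ?] := kM _ _ (cx i) (cx j).
by rewrite ger0_norm.
Qed.

Section Step.
Variables (J : finType) (c : T -> J) (v : J -> J -> R).
Hypothesis mc : forall j, measurable (c @^-1` [set j]).

Lemma measurable_unit_cell j : measurable (U `&` c @^-1` [set j]).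
Proof. by apply: measurableI => //; exact: measurable_unitI. Qed.

Definition step_prob := cell_prob (@measurable_unitI R) (lebesgue_unitI R) measurable_unit_cell.

Lemma hom_integral_step (F : sgraph 'I_k) :
  hom_integral F (fun x y => v (c x) (c y)) = (hom_mean (S := step_prob) v F)%:E.
Proof.
pose cell (x : k.-tuple T) := [ffun i => c (tnth x i)].
have boxE (y : {ffun 'I_k -> J}) : cube `&` cell @^-1` [set y] =
    [set x | forall i, (U `&` c @^-1` [set y i]) (tnth x i)].
  apply/seteqP; split=> x /=; first by move=> [cx <-] i; split; rewrite ?ffunE //; exact: cx.
  move=> h; split=> [i|]; first by case: (h i).
  by apply/ffunP => i; rewrite ffunE; case: (h i).
rewrite /hom_integral -/cube.
pose vv (y : {ffun 'I_k -> J}) :=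
  \prod_(i < k) \prod_(j < k | (i < j)%N && F i j) v (y i) (y j).
transitivity (\int[P]_(x in cube) (vv (cell x))%:E)%E.
  apply: eq_integral => x _; congr EFin; apply: eq_bigr => i _; apply: eq_bigr => j _.
  by rewrite !ffunE.
rewrite (integral_cells (cell := cell) vv).
- congr EFin; rewrite /hom_mean /mean; apply: eq_bigr => y _; rewrite mulrC; congr (_ * _).
  rewrite /= boxE (lebesgue_tuple_box (A := fun i => U `&` c @^-1` [set y i])).
    rewrite (eq_bigr (fun i => (fine (mu (U `&` c @^-1` [set y i])))%:E)).
      by rewrite prodEFin.
    move=> i _; rewrite fineK //; apply: (cell_fin_num (@measurable_unitI R)
      (lebesgue_unitI R)).
      exact: measurable_unit_cell.
    exact: subIsetl.
  by move=> i; exact: measurable_unit_cell.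
- exact: measurable_cube.
- exact: cube_lty.
- by move=> y; rewrite boxE; apply: (@measurable_box
    (fun i => U `&` c @^-1` [set y i])) => i; exact: measurable_unit_cell.
Qed.

End Step.

Lemma hom_integral_dist (F : sgraph 'I_k) (kappa kappa' : R -> R -> R) M e :
  1 <= M -> 0 <= e ->
  measurable_fun U2 (fun z => kappa z.1 z.2) ->
  measurable_fun U2 (fun z => kappa' z.1 z.2) ->
  (forall x y, unitI x -> unitI y -> 0 <= kappa x y <= M) ->
  (forall x y, unitI x -> unitI y -> 0 <= kappa' x y <= M) ->
  (L1_square (fun z => kappa z.1 z.2 - kappa' z.1 z.2)%R <= e%:E)%E ->
  (`|hom_integral F kappa - hom_integral F kappa'| <=
     (M ^+ (k * k) * ((k * k)%:R * e))%:E)%E.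
Proof.
move=> M1 e0 mk mk' kM kM' ke; have M0 : 0 <= M by apply: le_trans M1.
have I1 := integrable_hom_prod F mk kM; have I2 := integrable_hom_prod F mk' kM'.
have mC := measurable_cube.
pose f (x : k.-tuple T) := \prod_(i < k) \prod_(j < k | (i < j)%N && F i j) kappa
  (tnth x i) (tnth x j).
pose g (x : k.-tuple T) := \prod_(i < k) \prod_(j < k | (i < j)%N && F i j) kappa'
  (tnth x i) (tnth x j).
have -> : (hom_integral F kappa - hom_integral F kappa' =
  \int[P]_(x in cube) ((f x)%:E - (g x)%:E))%E by rewrite integralB_EFin.
have mf := measurable_hom_prod F mk; have mg := measurable_hom_prod F mk'.
have mfg : measurable_fun cube (fun x => f x - g x) by apply: measurable_funB.
apply: le_trans (le_abse_integral _ mC _) _.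
  by under eq_fun do rewrite -EFinB; exact/measurable_EFinP.
pose D (z : 'I_k * 'I_k) (x : k.-tuple T) :=
  if z.1 != z.2 then `|kappa (tnth x z.1) (tnth x z.2) - kappa' (tnth x z.1)
    (tnth x z.2)| else 0.
have mkk : measurable_fun U2 (fun z => kappa z.1 z.2 - kappa' z.1 z.2).
  exact: measurable_funB.
have mD z : measurable_fun cube (D z).
  rewrite /D; case: (z.1 != z.2) => //; apply: measurableT_comp => //.
  exact: (measurable_cube_coord2 z.1 z.2 mkk).
have D0 z x : 0 <= D z x by rewrite /D; case: ifP.
have Me : 0 <= M ^+ (k * k) by exact: exprn_ge0.
apply: (@le_trans _ _ (\int[P]_(x in cube)
  ((M ^+ (k * k))%:E * \sum_(z <- index_enum ('I_k * 'I_k)%type) (D z x)%:E))%E).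
  apply: ge0_le_integral => //.
  - by apply: measurableT_comp => //; under eq_fun do rewrite -EFinB; exact/measurable_EFinP.
  - by apply: measurable_funeM; apply: emeasurable_sum => z; exact/measurable_EFinP.
  move=> x cx; rewrite -EFinB abse_EFin sumEFin -EFinM lee_fin /f /g !pair_big_dep /=.
  have sz : size (index_enum ('I_k * 'I_k)%type) = (k * k)%N.
    by rewrite size_index_enum card_prod card_ord.
  rewrite -sz.
  have kM1 (z : 'I_k * 'I_k) := kM _ _ (cx z.1) (cx z.2).
  have kM2 (z : 'I_k * 'I_k) := kM' _ _ (cx z.1) (cx z.2).
  apply: le_trans (prod_dist_le _ _ M1 kM1 kM2) _.
  rewrite sz ler_wpM2l // big_mkcond /=; apply: ler_sum => -[i j] _ /=.
  case: ifP => [/andP[ij _]|_]; last exact: D0.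
  by rewrite /D /= -(inj_eq val_inj) neq_ltn ij.
rewrite ge0_integralZl_EFin //; last 2 first.
- by move=> x _; apply: sume_ge0 => z _; rewrite lee_fin.
- by apply: emeasurable_sum => z; exact/measurable_EFinP.
rewrite EFinM; apply: lee_wpmul2l; first by rewrite lee_fin.
rewrite ge0_integral_sum //; last 2 first.
- by move=> z; exact/measurable_EFinP.
- by move=> z x _; rewrite lee_fin.
apply: (@le_trans _ _ (\sum_(z <- index_enum ('I_k * 'I_k)%type) e%:E)%E).
  apply: lee_sum => -[i j] _; rewrite /D /=; case: eqVneq => [_|ij].
    by rewrite integral0 lee_fin.
  exact: le_trans (hom_integral_marginal ij mkk) ke.
by rewrite sumEFin big_const_seq count_predT size_index_enum card_prod card_ord iter_addr_0
  mulr_natl.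
Qed.

End HomIntegral.

(** * A graph and a step kernel on one finite space *)

Section UniformVertices.
Variables (R : realType) (n : nat).
Hypothesis n_gt0 : (0 < n)%N.

Let uwt_ge0 (i : 'I_n) : 0 <= n%:R^-1 :> R. Proof. by rewrite invr_ge0. Qed.

Let uwt_sum : \sum_(i < n) n%:R^-1 = 1 :> R.
Proof. by rewrite sumr_const card_ord -[LHS]mulr_natl mulfV // pnatr_eq0 -lt0n. Qed.

Definition uniform_prob : finprob R := @FinProb R 'I_n _ uwt_ge0 uwt_sum.

Definition scaled_adj (p : R) (G : sgraph 'I_n) (i j : 'I_n) : R :=
  if G i j then p^-1 else 0.

Lemma prod_if_cst (E : finType) (P b : pred E) (a : R) :
  \prod_(z | P z) (if b z then a else 0) =
  if [forall z, P z ==> b z] then a ^+ #|P| else 0.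
Proof.
case: ifP => [/forallP h|/negbT].
  by rewrite (eq_bigr (fun=> a)) ?prodr_const // => z Pz; have := h z; rewrite Pz /= => ->.
rewrite negb_forall => /existsP[z]; rewrite negb_imply => /andP[Pz /negPf bz].
by rewrite (bigD1 z) //= bz mul0r.
Qed.

Lemma t_densityE (p : R) k (F : sgraph 'I_k) (G : sgraph 'I_n) :
  t_density p F G = hom_mean (S := uniform_prob) (scaled_adj p G) F.
Proof.
rewrite /t_density /hom_mean /mean /nb_hom -sum1_card natr_sum mulr_suml.
rewrite big_mkcond /=; apply: eq_bigr => x _.
rewrite prodr_const card_ord pair_big_dep /=.
rewrite (prod_if_cst (fun z : 'I_k * 'I_k => (z.1 < z.2)%N && F z.1 z.2)
  (fun z => G (x z.1) (x z.2))).
rewrite -[#|_|]/(nb_edges F) unfold_in.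
have -> : [forall z : 'I_k * 'I_k, (z.1 < z.2)%N && F z.1 z.2 ==> G (x z.1) (x z.2)] =
          [forall a, forall b, F a b ==> G (x a) (x b)].
  apply/forallP/forallP => h => [a|[a b]].
    apply/forallP => b; apply/implyP => Fab; have [ab|ba|ab] := ltngtP a b.
    - by have := h (a, b); rewrite /= ab Fab.
    - by have := h (b, a); rewrite /= ba adj_sym Fab adj_sym.
    - by move: Fab; rewrite (val_inj ab) adj_irrefl.
  by apply/implyP => /= /andP[_ Fab]; have /forallP/(_ b) := h a; rewrite Fab.
case: ifP => _; last by rewrite mulr0.
by rewrite mul1r invfM !exprVn mulrC.
Qed.

End UniformVertices.

Section Pullback.
Variable R : realType.
Local Notation T := (measurableTypeR R).
Local Notation mu := (@lebesgue_measure R).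
Local Notation U := (@unitI R : set T).
Local Notation U2 := (U `*` U : set (T * T)).

(** Both sides are the integral over D of the indicator of phi o cell = j'. *)
Lemma cell_marginal d (X : measurableType d) (m : {measure set X -> \bar R})
    (J J' : finType) (D : set X) (cell : X -> J) (phi : J -> J') j' :
  measurable D -> (m D < +oo)%E ->
  (forall j, measurable (D `&` cell @^-1` [set j])) ->
  \sum_(j | phi j == j') fine (m (D `&` cell @^-1` [set j])) =
  fine (m (D `&` (fun x => phi (cell x)) @^-1` [set j'])).
Proof.
move=> mD mDoo mc.
have E1 := integral_cells (fun j => (phi j == j')%:R) mD mDoo mc.
have mc' j0 : measurable (D `&` (fun x => phi (cell x)) @^-1` [set j0]).
  exact: (measurable_cells (phi @^-1` [set j0]) mc).
have E2 := integral_cells (fun j => (j == j')%:R) mD mDoo mc'.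
have := EFin_inj (etrans (esym E1) E2).
rewrite [X in _ = X -> _](bigD1 j') //= eqxx mul1r.
rewrite [X in _ = _ + X -> _]big1 ?addr0 => [<-|j /negPf ->]; last by rewrite mul0r.
by rewrite big_mkcond /=; apply: eq_bigr => j _; case: eqP; rewrite ?mul1r ?mul0r.
Qed.

(* graph_kernel vanishes on the axes, so its grid cells only cover (0, 1]. *)
Local Notation D1 := (`]0, 1]%classic : set T).

Let mD1 : measurable D1. Proof. exact: measurable_itv. Qed.

Let D1_1 : mu D1 = 1%E.
Proof. by rewrite lebesgue_measure_itv /= lte_fin ltr01 oppr0 adde0. Qed.

Let D1_lty : (mu D1 < +oo)%E. Proof. by rewrite D1_1 ltry. Qed.

Let D1U : D1 `<=` U.
Proof. by move=> x; rewrite /unitI /= !in_itv /= => /andP[/ltW -> ->]. Qed.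

Lemma measure_D1I (X : set T) : measurable (U `&` X) -> mu (D1 `&` X) = mu (U `&` X).
Proof.
move=> mX; have mDX : measurable (D1 `&` X).
  by rewrite -(setIidl D1U) -setIA; apply: measurableI.
have E : U `&` X = (D1 `&` X) `|` ([set 0] `&` (U `&` X)).
  apply/seteqP; split=> x /=; rewrite /unitI /= !in_itv /=.
    move=> [/andP[x0 x1] Xx]; have [x00|x00] := eqVneq x 0.
      by right; rewrite x0 x1.
    by left; rewrite lt_neqAle eq_sym x00 x0 x1.
  by move=> [[/andP[/ltW -> ->]]|[_ []]].
have m0 : measurable ([set 0 : T] `&` (U `&` X)) by apply: measurableI => //;
  exact: measurable_set1.
rewrite [in RHS]E measureU //; last first.
  by apply/seteqP; split=> // x /= [[]]; rewrite in_itv /= => /andP[x0 _] _ [x0' _];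
    move: x0; rewrite x0' ltxx.
have z0 : mu ([set 0 : T] `&` (U `&` X)) = 0%E.
  apply: (subset_measure0 m0 (measurable_set1 0)); first exact: subIsetl.
  exact: lebesgue_measure_set1.
by rewrite [X in (_ + X)%E](_ : _ = 0%E) ?adde0.
Qed.

Section Grid.
Variable n : nat.
Hypothesis n_gt0 : (0 < n)%N.

Definition grid_itv (i : 'I_n) : set T := `]i%:R / n%:R, i.+1%:R / n%:R]%classic.

Definition grid_index (x : T) : 'I_n :=
  odflt (Ordinal n_gt0) [pick i : 'I_n | i%:R / n%:R < x <= i.+1%:R / n%:R].

Let n0 : 0 < n%:R :> R. Proof. by rewrite ltr0n. Qed.

Lemma grid_index_uniq (x : R) (i j : 'I_n) :
  i%:R / n%:R < x <= i.+1%:R / n%:R -> j%:R / n%:R < x <= j.+1%:R / n%:R -> i = j.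
Proof.
have half (a b : 'I_n) : a%:R / n%:R < x -> x <= b.+1%:R / n%:R -> (a <= b)%N.
  move=> h1 h2; have := lt_le_trans h1 h2.
  by rewrite ltr_pM2r ?invr_gt0 // ltr_nat ltnS.
move=> /andP[i1 i2] /andP[j1 j2]; apply: val_inj; apply/eqP.
by rewrite eqn_leq (half i j) // (half j i).
Qed.

Lemma grid_indexP (x : R) : D1 x ->
  (grid_index x)%:R / n%:R < x <= (grid_index x).+1%:R / n%:R.
Proof.
rewrite /= in_itv /= => /andP[x0 x1]; rewrite /grid_index; case: pickP => //= none.
have ex : exists i, (x <= i.+1%:R / n%:R) && (i < n)%N.
  by exists n.-1; rewrite prednK // mulfV ?gt_eqF // x1 leqnn.
have [i /andP[xi iN] imin] := ex_minnP ex.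
have := none (Ordinal iN); rewrite /= xi andbT => /negbT; rewrite -leNgt => xi'.
case: i => [|i] in xi iN imin xi'; first by move: xi'; rewrite mul0r leNgt x0.
by have := imin i; rewrite xi' (ltnW iN) ltnn => /(_ isT).
Qed.

Lemma grid_itvE (i : 'I_n) : D1 `&` grid_index @^-1` [set i] = grid_itv i.
Proof.
apply/seteqP; split=> x.
  by move=> [Dx /= <-]; rewrite /grid_itv /= in_itv /=; exact: grid_indexP.
rewrite /grid_itv /= in_itv /= => xi.
have Dx : D1 x.
  rewrite /= in_itv /=; case/andP: xi => x1 x2; apply/andP; split.
    by apply: le_lt_trans x1; rewrite divr_ge0 // ltW.
  by apply: le_trans x2 _; rewrite ler_pdivrMr // mul1r ler_nat.
split=> //; exact: grid_index_uniq (grid_indexP Dx) xi.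
Qed.

Lemma measure_grid_itv i : mu (grid_itv i) = (n%:R^-1)%:E.
Proof.
rewrite lebesgue_measure_itv /= lte_fin ltr_pM2r ?invr_gt0 // ltr_nat ltnSn.
by rewrite -EFinB -mulrBl -natrB // subSnn mul1r.
Qed.

Lemma graph_kernelE (p : R) (G : sgraph 'I_n) x y : D1 x -> D1 y ->
  graph_kernel p G x y = scaled_adj p G (grid_index x) (grid_index y).
Proof.
move=> Dx Dy; rewrite /graph_kernel /scaled_adj.
have hx := grid_indexP Dx; have hy := grid_indexP Dy.
case: ifP => [/existsP[i /existsP[j /and3P[Gij xi yj]]]|/negbT].
  by rewrite (grid_index_uniq hx xi) (grid_index_uniq hy yj) Gij.
case: ifP => // Gxy /existsP[]; exists (grid_index x); apply/existsP.
by exists (grid_index y); rewrite Gxy hx hy.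
Qed.

Section System.
Variables (p : R) (G : sgraph 'I_n) (tau : T -> T).
Hypothesis tauP : mp_bijection tau.
Variables (J : finType) (c : T -> J) (v : J -> J -> R).
Hypothesis mc : forall j, measurable (c @^-1` [set j]).

Let tauU x : U x -> U (tau x).
Proof. by case: tauP => -[h _ _] _ _; exact: h. Qed.

Let mtau (Y : set T) : measurable Y -> measurable (U `&` tau @^-1` Y).
Proof. by case: tauP => _ h _ mY; apply: h => //; exact: measurable_unitI. Qed.

Let mutau (A : set T) : measurable A -> A `<=` U -> mu (U `&` tau @^-1` A) = mu A.
Proof. by case: tauP => _ _; apply. Qed.

(** The common refinement of the grid and of the partition c o tau: the first
    coordinate carries the graph, the second one the step kernel. *)
Definition pull_cell (x : T) : 'I_n * J := (grid_index x, c (tau x)).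

Lemma measurable_pull_cell s : measurable (D1 `&` pull_cell @^-1` [set s]).
Proof.
rewrite (_ : _ `&` _ = grid_itv s.1 `&` (U `&` tau @^-1` (c @^-1` [set s.2]))).
  by apply: measurableI; [exact: measurable_itv|exact: mtau].
rewrite -grid_itvE; apply/seteqP; split=> x /=.
  by move=> [Dx <-]; do !split=> //; exact: D1U.
by move=> [[Dx i1] [_ j1]]; split=> //; case: s i1 j1 => i j /= <- <-.
Qed.

Definition pull_prob := cell_prob mD1 D1_1 measurable_pull_cell.

Lemma pull_prob_fst i : \sum_(s : pull_prob | s.1 == i) wt s = n%:R^-1.
Proof.
rewrite (cell_marginal (fun s : 'I_n * J => s.1) i mD1 D1_lty measurable_pull_cell).
transitivity (fine (mu (grid_itv i))); last by rewrite measure_grid_itv.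
by congr (fine (mu _)); exact: grid_itvE.
Qed.

Lemma pull_prob_snd j : \sum_(s : pull_prob | s.2 == j) wt s = wt (j : step_prob mc).
Proof.
rewrite (cell_marginal (fun s : 'I_n * J => s.2) j mD1 D1_lty measurable_pull_cell).
transitivity (fine (mu (U `&` tau @^-1` (c @^-1` [set j])))).
  by congr fine; exact: (measure_D1I (mtau (mc j))).
transitivity (fine (mu (U `&` c @^-1` [set j]))) => //; congr fine.
rewrite -[RHS]mutau; last 2 first.
- exact: measurable_unit_cell.
- exact: subIsetl.
congr (mu _); apply/seteqP; split=> x /= [Ux].
  by move=> h; do !split=> //; exact: tauU.
by move=> [_ h].
Qed.

Definition pull_W (s t : pull_prob) : R := scaled_adj p G s.1 t.1.
Definition pull_K (s t : pull_prob) : R := v s.2 t.2.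

Lemma pull_hom_W k (F : sgraph 'I_k) : hom_mean pull_W F = t_density p F G.
Proof.
rewrite (t_densityE n_gt0).
apply: etrans (mean_push (S := pull_prob) (T := uniform_prob R n_gt0) (phi :=
  fst) _ pull_prob_fst).
apply: eq_mean => x; apply: eq_bigr => i _; apply: eq_bigr => j _; by rewrite !ffunE.
Qed.

Lemma pull_hom_K k (F : sgraph 'I_k) :
  hom_mean pull_K F = hom_mean (S := step_prob mc) v F.
Proof.
apply: etrans (mean_push (S := pull_prob) (T := step_prob mc) (phi := snd) _ pull_prob_snd).
apply: eq_mean => x; apply: eq_bigr => i _; apply: eq_bigr => j _; by rewrite !ffunE.
Qed.

Variables (kappa : R -> R -> R) (M : R).
Hypothesis mkappa : measurable_fun U2 (fun z => kappa z.1 z.2).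
Hypothesis kappaM : forall x y, unitI x -> unitI y -> 0 <= kappa x y <= M.
Hypothesis vM : forall a b, 0 <= v a b <= M.

Let h (z : T * T) := kappa z.1 z.2 - v (c z.1) (c z.2).

Let mh : measurable_fun U2 h.
Proof.
by apply: measurable_funB => //; exact: (measurable_funTS (measurable_step mc v)).
Qed.

Let hM z : U2 z -> `|h z| <= M.
Proof.
move=> [z1 z2]; rewrite /h ler_norml.
have := kappaM z1 z2; have := vM (c z.1) (c z.2); lra.
Qed.

(* tau is measurable and stable only on the unit interval, hence the patch. *)
Let tau2 (z : T * T) := ((tau \_ U) z.1, (tau \_ U) z.2).

Let tauE x : U x -> (tau \_ U) x = tau x.
Proof. by move=> Ux; rewrite patchE mem_set. Qed.

Let tau2E z : U2 z -> tau2 z = (tau z.1, tau z.2).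
Proof. by move=> [z1 z2]; rewrite /tau2 !tauE. Qed.

Let mtau2 : measurable_fun setT tau2.
Proof.
have mt : measurable_fun setT (tau \_ U).
  have mt : measurable_fun U tau by case: tauP.
  exact: ((measurable_restrictT tau (@measurable_unitI R)).1 mt).
apply: measurable_fun_pair.
  exact: (measurableT_comp mt measurable_fst).
exact: (measurableT_comp mt measurable_snd).
Qed.

Let mU2 : measurable U2. Proof. exact: measurable_square. Qed.

Let tau2U : [set tau2 z | z in U2] `<=` U2.
Proof. by move=> _ [z Uz <-]; rewrite tau2E //; case: Uz => ? ?; split; exact: tauU. Qed.

Let mhtau : measurable_fun U2 (fun z => h (tau2 z)).
Proof. exact: (measurable_comp mU2 tau2U mh (measurable_funTS mtau2)). Qed.

Lemma L1_square_tau : (\int[mu \x mu]_(z in U2) (`|h (tau2 z)|)%:E <= L1_square h)%E.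
Proof.
apply: (@integral_square_le _ _ _ _ U2 tau2 (fun z => (`|h z|)%:E)) => //.
- by move=> z Uz; apply: tau2U; exists z.
- move=> A B mA mB AU BU.
  rewrite (_ : _ `&` _ = (U `&` tau @^-1` A) `*` (U `&` tau @^-1` B)).
    rewrite -(mutau mA AU) -(mutau mB BU).
    by apply: product_measure1E; exact: mtau.
  apply/seteqP; split=> z /=.
    by move=> [[Az Bz] [z1 z2]]; move: Az Bz; rewrite !tauE.
  by move=> [[z1 Az] [z2 Bz]]; rewrite !tauE.
- by apply/measurable_EFinP; exact: measurableT_comp.
Qed.

(** Test sets of cells are test sets for the cut norm, and on them the step
    kernel differs from kappa o tau by the L1 error of the approximation, which
    tau preserves. *)
Lemma pull_cut dlt e :
  (cut_norm (fun x y => (graph_kernel p G x y - kappa (tau x) (tau y))%R) <= dlt%:E)%E ->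
  (L1_square h <= e%:E)%E ->
  forall A B : pred pull_prob,
  `|mean (fun s => mean (fun t => (A s)%:R * (B t)%:R * (pull_W s t - pull_K s t)))| <= dlt + e.
Proof.
move=> hcut he A B.
pose SA := D1 `&` pull_cell @^-1` [set s | A s].
pose SB := D1 `&` pull_cell @^-1` [set s | B s].
have mSA : measurable SA by exact: measurable_cells measurable_pull_cell.
have mSB : measurable SB by exact: measurable_cells measurable_pull_cell.
have SAU : SA `<=` U by move=> x [/D1U].
have SBU : SB `<=` U by move=> x [/D1U].
pose D := SA `*` SB : set (T * T).
have mD : measurable D by exact: measurableX.
have DU : D `<=` U2 by move=> z [/SAU ? /SBU ?]; split.
have Doo : ((mu \x mu)%E D < +oo)%E.
  apply: (@le_lt_trans _ _ ((mu \x mu)%E U2)); last by rewrite lebesgue_square ltry.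
  by apply: le_measure; rewrite ?inE.
pose cell2 (z : T * T) : pull_prob * pull_prob := (pull_cell z.1, pull_cell z.2).
pose w (st : pull_prob * pull_prob) := pull_W st.1 st.2 - pull_K st.1 st.2.
pose bx (b : bool) s : set T := if b then D1 `&` pull_cell @^-1` [set s] else set0.
have mbx b s : measurable (bx b s) by rewrite /bx; case: b => //; exact: measurable_pull_cell.
have cell2E st : D `&` cell2 @^-1` [set st] = bx (A st.1) st.1 `*` bx (B st.2) st.2.
  case: st => s t; apply/seteqP; split=> -[x y] /=.
    by move=> [[[Dx Ax] [Dy By]] [<- <-]]; rewrite /bx Ax By.
  rewrite /bx; case As: (A s); last by case.
  case Bt: (B t); last by case.
  move=> [[Dx xs] [Dy yt]]; split; last by rewrite /cell2 /= xs yt.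
  by split; split=> //=; rewrite ?xs ?yt.
have mcell2 st : measurable (D `&` cell2 @^-1` [set st]).
  by rewrite cell2E; exact: measurableX.
have IE := integral_cells w mD Doo mcell2.
have -> : mean (fun s => mean (fun t => (A s)%:R * (B t)%:R * (pull_W s t - pull_K s t))) =
    \sum_st w st * fine ((mu \x mu)%E (D `&` cell2 @^-1` [set st])).
  pose g s t := w (s, t) * ((A s)%:R * (B t)%:R * (wt s * wt t)).
  transitivity (\sum_(st : pull_prob * pull_prob) g st.1 st.2); last first.
    apply: eq_bigr => -[s t] _; rewrite /g /=; congr (_ * _).
    rewrite cell2E /= (product_measure1E mu mu (mbx _ _) (mbx _ _)) /bx.
    case: (A s); last by rewrite measure0 mul0e !mul0r.
    case: (B t); last by rewrite measure0 mule0 mulr0 mul0r.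
    rewrite !mul1r fineM //.
      exact: (cell_fin_num mD1 D1_1 (measurable_pull_cell s) (@subIsetl _ _ _)).
    exact: (cell_fin_num mD1 D1_1 (measurable_pull_cell t) (@subIsetl _ _ _)).
  rewrite -(pair_bigA _ g) /=.
  rewrite /mean; apply: eq_bigr => s _; rewrite mulr_sumr; apply: eq_bigr => t _.
  by rewrite /g /w /=; ring.
set r := \sum_st _ in IE *.
pose f2 z := h (tau2 z).
have mf2 : measurable_fun D f2 by exact: measurable_funS mhtau.
have If2 : (mu \x mu)%E.-integrable D (EFin \o f2).
  apply: measurable_bounded_integrable => //; exists M; split; first exact: num_real.
  move=> N MN z Dz; apply: le_trans (ltW MN); apply: hM; apply: tau2U.
  by exists z => //; exact: DU.
have Iw : (mu \x mu)%E.-integrable D (EFin \o (fun z => w (cell2 z))).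
  apply: measurable_bounded_integrable => //; first exact: (measurable_fun_cells w mcell2).
  exists (\sum_st `|w st|); split; first exact: num_real.
  move=> N MN z Dz; apply: le_trans (ltW MN).
  by rewrite (bigD1 (cell2 z)) //= lerDl sumr_ge0.
have If2fin := integrable_fin_num mD If2.
set s := fine (\int[mu \x mu]_(z in D) (f2 z)%:E)%E.
have sE : (\int[mu \x mu]_(z in D) (f2 z)%:E = s%:E)%E by rewrite /s fineK.
have se : `|s| <= e.
  rewrite -lee_fin -abse_EFin -sE; apply: le_trans (le_trans L1_square_tau he).
  apply: le_trans (le_abse_integral _ mD _) _; first exact/measurable_EFinP.
  apply: ge0_subset_integral => //; apply/measurable_EFinP; exact: measurableT_comp.
have rs : `|r - s| <= dlt.
  rewrite -lee_fin; apply: le_trans hcut; apply: ereal_sup_ubound.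
  exists SA, SB; split=> //.
  rewrite -abse_EFin EFinB -IE -sE -integralB_EFin //; congr (`| _ |)%E.
  apply: eq_integral => -[x y]; rewrite inE => Dz.
  have /= Uz := DU _ Dz; case: Dz => -[/= Dx _] [/= Dy _].
  rewrite -EFinB; congr EFin; rewrite /f2 tau2E // /h /w /= graph_kernelE //.
  by rewrite /pull_W /pull_K /=; ring.
rewrite (_ : r = (r - s) + s); last by ring.
by apply: le_trans (ler_normD _ _) _; exact: lerD.
Qed.

End System.
End Grid.
End Pullback.

(** * The limit of the densities *)

(** The index type of the family to which the counting lemma is applied.  The
    bounds B are shared by all members, so that the counting lemma is uniform
    in n, in the rearrangement and in the step kernel. *)
Record cut_system (R : realType) (l : nat) (M : R)
    (B : forall k, sgraph 'I_k -> R) := CutSystem {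
  cs_space : finprob R;
  cs_W : cs_space -> cs_space -> R;
  cs_K : cs_space -> cs_space -> R;
  cs_eps : R;
  cs_W_ge0 : forall x y, 0 <= cs_W x y;
  cs_W_sym : forall x y, cs_W x y = cs_W y x;
  cs_K_bnd : forall x y, 0 <= cs_K x y <= M;
  cs_K_sym : forall x y, cs_K x y = cs_K y x;
  cs_cut : forall A B : pred cs_space,
    `|mean (fun x => mean (fun y => (A x)%:R * (B y)%:R * (cs_W x y - cs_K x y)))|
    <= cs_eps;
  cs_bnd : forall k (F : sgraph 'I_k),
    is_tree F \/ in_Fge l F \/ graph_iso F (cycle_graph (2 * l - 2)) ->
    hom_mean cs_W F <= B k F }.

Theorem theorem5p15 (R : realType) (l : nat) (hl : (3 <= l)%N)
    (A : set nat) (hA : infinite_set A)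
    (p : nat -> R) (hp : forall n, A n -> 0 < p n)
    (G : forall n : nat, sgraph 'I_n)
    (hsup : forall (k : nat) (F : sgraph 'I_k),
       is_tree F \/ in_Fge l F \/ graph_iso F (cycle_graph (2 * l - 2)) ->
       (ereal_sup [set (t_density (p n) F (G n))%:E | n in A] < +oo)%E)
    (kappa : R -> R -> R)
    (hkernel : is_kernel kappa) (hbounded : bounded_kernel kappa)
    (hcut : d_cut (graph_kernel (p n) (G n)) kappa
              @[n --> within A \oo] --> 0%E)
    (k : nat) (F : sgraph 'I_k) (hF : is_tree F \/ in_Fge l F) :
  (t_density (p n) F (G n))%:E @[n --> within A \oo] --> hom_integral F kappa.
Proof.
have [mk ksym k0] := hkernel; have [M0 kM0] := hbounded.
pose M := Num.max 1 M0; have M1 : 1 <= M by rewrite le_max lexx.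
have M_gt0 : 0 < M by apply: lt_le_trans M1.
have kM x y : unitI x -> unitI y -> 0 <= kappa x y <= M.
  by move=> Ux Uy; rewrite k0 //= le_max kM0 ?orbT.
pose B k (F : sgraph 'I_k) := fine (ereal_sup [set (t_density (p n) F (G n))%:E | n in A]).
have tB k' (F' : sgraph 'I_k') n : A n ->
    is_tree F' \/ in_Fge l F' \/ graph_iso F' (cycle_graph (2 * l - 2)) ->
    t_density (p n) F' (G n) <= B k' F'.
  move=> An /hsup supoo.
  have le : ((t_density (p n) F' (G n))%:E <=
      ereal_sup [set (t_density (p n) F' (G n))%:E | n in A])%E.
    by apply: ereal_sup_ubound; exists n.
  rewrite -lee_fin fineK // fin_numElt supoo andbT.
  by apply: lt_le_trans le; rewrite ltNyr.
have csB k' (F' : sgraph 'I_k') :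
    is_tree F' \/ in_Fge l F' \/ graph_iso F' (cycle_graph (2 * l - 2)) ->
    exists C, forall i : cut_system l M B, hom_mean (@cs_W _ _ _ _ i) F' <= C.
  by move=> hF'; exists (B k' F') => i; exact: cs_bnd.
have van := @finite_counting R (cut_system l M B) (@cs_space _ _ _ _) (@cs_W _ _ _ _)
  (@cs_K _ _ _ _) (@cs_eps _ _ _ _) M (@cs_W_ge0 _ _ _ _) (@cs_W_sym _ _ _ _) M_gt0
  (@cs_K_bnd _ _ _ _) (@cs_K_sym _ _ _ _) (@cs_cut _ _ _ _) l hl
  csB k F hF.
have intF := integrable_hom_prod F mk kM.
have finF : hom_integral F kappa \is a fin_num by apply: integrable_fin_num intF;
  exact: measurable_cube.
rewrite -(fineK finF); set L := fine _.
apply: cvg_EFin; first by near=> n.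
apply/cvgrPdist_le => e e0.
have e2 : 0 < e / 2 by lra.
have [d d0 hd] := van _ e2.
have d2 : 0 < d / 2 by lra.
pose C := M ^+ (k * k) * (k * k)%:R.
have C0 : 0 <= C by rewrite mulr_ge0 ?exprn_ge0 // ltW.
(* e' bounds the L1 error of the step kernel: it takes up at most half of the
   admissible cut distance d and changes the integral by at most e / 2. *)
pose e' := Num.min (d / 2) (e / 2 / (C + 1)).
have C1 : 0 < C + 1 by rewrite ltr_wpDl.
have e'0 : 0 < e' by rewrite lt_min d2 divr_gt0.
have Ce' : C * e' <= e / 2.
  apply: (@le_trans _ _ ((C + 1) * (e / 2 / (C + 1)))).
    apply: ler_pM => //; [exact: ltW|by rewrite lerDl|by rewrite ge_min lexx orbT].
  by rewrite le_eqVlt; apply/orP; left; apply/eqP; field; rewrite gt_eqF.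
have kM' x y : unitI x -> unitI y -> kappa x y <= M by move=> Ux Uy;
  have /andP[] := kM x y Ux Uy.
have [J [c [v [mc vM vsym cv]]]] := kernel_step_approx hkernel kM' e'0.
have mv : measurable_fun (@unitI R `*` @unitI R) (fun z : R * R => v (c z.1) (c z.2)).
  exact: (measurable_funTS (measurable_step mc v)).
have dist := hom_integral_dist F M1 (ltW e'0) mk mv kM (fun x y _ _ => vM (c x) (c y)) cv.
have {}dist : `|L - hom_mean (S := step_prob mc) v F| <= e / 2.
  apply: le_trans Ce'; rewrite -lee_fin /C -mulrA; apply: le_trans dist.
  by rewrite hom_integral_step -(fineK finF) -EFinB.
have near_cut : \forall n \near within A \oo,
    (d_cut (graph_kernel (p n) (G n)) kappa < (d / 2)%:E)%E.
  exact: (hcut _ (@nbhs_open_ereal_lt _ 0 (fun=> d / 2) d2)).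
have near_pos : \forall n \near within A \oo, A n /\ (0 < n)%N.
  by rewrite near_withinE; exists 1%N => // n /= n1 An.
near=> n.
have [An n0] : A n /\ (0 < n)%N by near: n.
have : (d_cut (graph_kernel (p n) (G n)) kappa < (d / 2)%:E)%E by near: n.
move=> /ereal_inf_lt[_ [tau tauP <-] /ltW cutn].
have e'd : e' <= d / 2 by rewrite ge_min lexx.
have cv' : (L1_square (fun z => kappa z.1 z.2 - v (c z.1) (c z.2))%R <= (d / 2)%:E)%E.
  by apply: le_trans cv _; rewrite lee_fin.
have cutAB := pull_cut (n_gt0 := n0) (tauP := tauP) (mc := mc) mk kM vM cutn cv'.
pose S := pull_prob n0 tauP mc.
have W0 (s t : S) : 0 <= pull_W (p n) (G n) s t.
  by rewrite /pull_W /scaled_adj; case: ifP => // _; rewrite invr_ge0 ltW // hp.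
have Ws (s t : S) : pull_W (p n) (G n) s t = pull_W (p n) (G n) t s.
  by rewrite /pull_W /scaled_adj adj_sym.
have Wb k' (F' : sgraph 'I_k') :
    is_tree F' \/ in_Fge l F' \/ graph_iso F' (cycle_graph (2 * l - 2)) ->
    hom_mean (fun s t : S => pull_W (p n) (G n) s t) F' <= B k' F'.
  by move=> hF'; rewrite pull_hom_W; exact: tB.
have := hd (@CutSystem R l M B S _ (fun s t : S => pull_K v s t) _ W0 Ws
  (fun s t => vM s.2 t.2) (fun s t => vsym s.2 t.2) cutAB Wb).
rewrite /= -splitr lexx pull_hom_W pull_hom_K => /(_ isT) h.
by move: dist h; rewrite !ler_norml => /andP[? ?] /andP[? ?]; apply/andP; split; lra.
Unshelve. all: by end_near.
Qed.
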